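(* Let $g\in L^2(\Omega)$ and $f\in L^2(\Omega)$, and denote $g_k=(g,\varphi_k)$ and $f_k=(f,\varphi_k)$. Then, for any $\zeta_1,\zeta_2>0$, there exist truncated approximations $$g_N=\sum_{k=1}^Ng_k\varphi_k,\qquad f_N=\sum_{k=1}^Nf_k\varphi_k,$$ such that $\|g-g_N\|\le\zeta_1$ and $\|f-f_N\|\le\zeta_2$. Let $\tilde g_{N,\tau,r}^\delta$ be the finite-dimensional exponential quasi-boundary value regularized solution, where the regularization parameter $\tau>0$ is chosen by the Morozov discrepancy principle $\|K\tilde g_{N,\tau,r}^\delta-\hat h_N^\delta\|=\rho\delta$, with $\rho>1$ a prescribed constant. Then, for any fixed $p>0$, the following estimate holds: $$\|\tilde g_{N,\tau,r}^{\delta}-g\|\le C_N\left[(1+\rho)^{\frac{p}{p+2}}\delta^{\frac{p}{p+2}}+\zeta_2^{\frac{p}{p+2}}+\zeta_1^{\frac{p}{p+2}}\right]+\zeta_1 .$$ Here $C_N>0$ is a constant depending on $N$, $p$, $r$ and the exact data, but independent of $\delta$, $\tau$, $\rho$, $\zeta_1$ and $\zeta_2$.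
   Context: Fix $\alpha\in(0,1]$, $\beta\ge 0$, $l>0$, $r\in\mathbb{R}$, and a bounded connected domain $\Omega\subset\mathbb{R}^d$ ($d\ge1$) with smooth boundary. $(\cdot,\cdot)$ and $\|\cdot\|$ are the inner product and norm of $L^2(\Omega)$. $-L:H^2(\Omega)\cap H_0^1(\Omega)\to L^2(\Omega)$ is a symmetric uniformly elliptic operator with eigenpairs $-L\varphi_k=\lambda_k\varphi_k$, $0<\lambda_1\le\lambda_2\le\cdots\to\infty$, where $\{\varphi_k\}_{k\ge1}$ is a complete orthonormal basis of $L^2(\Omega)$. Kilbas–Saigo function: $E_{\alpha,m,n}(z)=1+\sum_{k=1}^\infty\prod_{j=0}^{k-1}\frac{\Gamma(\alpha(jm+n)+1)}{\Gamma(\alpha(jm+n+1)+1)}z^k$ ($\alpha,m>0$, $n>-1/\alpha$). Put $\eta_2=\frac{\Gamma(1+\beta)}{\Gamma(1+\alpha+\beta)}$, $e_k=E_{\alpha,1+\frac{\beta}{\alpha},\frac{\beta}{\alpha}}(-\sqrt{\lambda_k}\,l^{\alpha+\beta})$ and $$\sigma_k=\frac{\eta_2}{\sqrt{\lambda_k}}\,l^{\alpha+\beta}E_{\alpha,1+\frac{\beta}{\alpha},1+\frac{2\beta}{\alpha}}\left(-\sqrt{\lambda_k}\,l^{\alpha+\beta}\right),\qquad Kv=\sum_{k=1}^\infty\sigma_k(v,\varphi_k)\varphi_k .$$ The exact trace at $x=l$ is $h=\sum_{k=1}^\infty f_ke_k\varphi_k-Kg$ (i.e. $h=u(l,\cdot)$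 for the underlying fractional elliptic boundary value problem with boundary datum $f$ and source $g$). The noisy trace $h^\delta\in L^2(\Omega)$ satisfies $\|h^\delta-h\|\le\delta$, $\delta>0$. The noisy finite-dimensional data are $$\hat h_N^\delta=\sum_{k=1}^Nf_ke_k\varphi_k-h^\delta,\qquad \hat h_{N,k}^\delta=f_ke_k-(h^\delta,\varphi_k)\quad(1\le k\le N),$$ and for $\tau>0$ the finite-dimensional exponential quasi-boundary value regularized solution is $$\tilde g_{N,\tau,r}^\delta=\sum_{k=1}^N\frac{1}{\sigma_k+\tau\exp(\lambda_k^r)}\,\hat h_{N,k}^\delta\,\varphi_k .$$
   Formalization: For p<2 no C_N is uniform over all δ>0 and ρ>1 (it fails as δ→∞, ρ→1); so a bound M>0 is fixed first, C_N may depend on M, and the estimate is claimed when δ≤M, or ρ≥1+1/M, or p≥2. *)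

(* Defs.v *)
(* Mathematical Components + MathComp-Analysis, over an arbitrary R : realType. *)
From HB Require Import structures.
From mathcomp Require Import all_boot all_order all_algebra.
From mathcomp Require Import all_classical all_reals all_analysis.
Set Implicit Arguments.
Unset Strict Implicit.
Unset Printing Implicit Defensive.
Import Order.TTheory GRing.Theory Num.Theory.
Import numFieldNormedType.Exports.
Local Open Scope classical_set_scope.
Local Open Scope ring_scope.

Definition rV_display : measure_display. Proof. exact. Qed.

Section rV_measurable.
Variables (R : realType) (d : nat).

Definition rV_coord (i : 'I_d) : 'rV[R]_d -> measurableTypeR R :=
  fun x => x ord0 i.

(* The sigma-algebra generated by the coordinates, i.e. the Borel sets of R^d. *)
HB.instance Definition _ := @isMeasurable.Build rV_display 'rV[R]_d
  (g_sigma_preimage rV_coord) (@sigma_algebra0 _ _ _)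
  (@sigma_algebraC _ _) (@sigma_algebra_bigcup _ _ _).

End rV_measurable.

Definition rV_cons (R : realType) (d : nat)
    (p : 'rV[R]_d * measurableTypeR R) : 'rV[R]_d.+1 :=
  row_mx (p.2%:M : 'rV[R]_1) p.1.

Lemma measurable_rV_coord (R : realType) (d : nat) (i : 'I_d) :
  measurable_fun setT (@rV_coord R d i).
Proof.
move=> _ Y mY; rewrite setTI; apply: sub_sigma_algebra => /=.
rewrite -bigcup_seq/=; exists i => /=; first by rewrite mem_index_enum.
by exists Y => //; rewrite setTI.
Qed.

Lemma measurable_rV_cons (R : realType) (d : nat) :
  measurable_fun setT (@rV_cons R d).
Proof.
apply: measurability; first by reflexivity.
move=> _ [B /= + <-]; rewrite -bigcup_seq/= => -[i _ [A mA <-]].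
have mc : measurable_fun setT (rV_coord i \o @rV_cons R d).
  rewrite /comp /rV_coord /rV_cons.
  case: (split_ordP (i : 'I_(1 + d))) => j ->.
    apply: (eq_measurable_fun snd) => // x _.
    by rewrite (row_mxEl (x.2%:M : 'rV[R]_1) x.1) (ord1 j) mxE eqxx mulr1n.
  apply: (eq_measurable_fun (rV_coord j \o fst)) => [x _|].
    by rewrite (row_mxEr (x.2%:M : 'rV[R]_1) x.1).
  by apply: measurableT_comp => //; exact: measurable_rV_coord.
have := mc measurableT A mA.
by rewrite !setTI.
Qed.

HB.instance Definition _ (R : realType) (d : nat) :=
  isMeasurableFun.Build _ _ _ _ (@rV_cons R d) (@measurable_rV_cons R d).

Section lebesgue_step.
Local Open Scope ereal_scope.
Context {R : realType} {d : nat}.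
Variable mu : {measure set 'rV[R]_d -> \bar R}.

Definition lebesgue_step : set 'rV[R]_d.+1 -> \bar R :=
  pushforward (mu \x @lebesgue_measure R) (@rV_cons R d).

Let lebesgue_step0 : lebesgue_step set0 = 0.
Proof. exact: measure0. Qed.

Let lebesgue_step_ge0 A : 0 <= lebesgue_step A.
Proof. exact: measure_ge0. Qed.

Let lebesgue_step_sigma_additive : semi_sigma_additive lebesgue_step.
Proof. exact: measure_semi_sigma_additive. Qed.

HB.instance Definition _ := isMeasure.Build _ _ _ lebesgue_step
  lebesgue_step0 lebesgue_step_ge0 lebesgue_step_sigma_additive.

End lebesgue_step.

(* Lebesgue measure on R^d: the d-fold product of Lebesgue measure on R,
   transported along R^d * R ~ R^(d+1); R^0 carries the unit point mass. *)
Fixpoint lebesgue_rV (R : realType) (d : nat)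
    : {measure set 'rV[R]_d -> \bar R} :=
  match d with
  | 0 => dirac (0 : 'rV[R]_0)
  | d'.+1 => lebesgue_step (lebesgue_rV R d')
  end.

Section L2_space.
Variables (R : realType) (d : nat) (Omega : set 'rV[R]_d).
Local Notation mu := (lebesgue_rV R d).
Implicit Types u v w : 'rV[R]_d -> R.

(* Elements of L^2(Omega) are represented by functions on R^d, of which only
   the restriction to Omega matters (u \_ Omega is u extended by 0 outside of
   Omega); equality in L^2(Omega) is [ae_eq_on]. *)
Definition L2 u : Prop := u \_ Omega \in Lfun mu 2%:E.

Definition ae_eq_on u v : Prop := {ae mu, forall x, Omega x -> u x = v x}.

Definition inner u v : R := \int[mu]_(x in Omega) (u x * v x).

Definition norm2 u : R := Num.sqrt (inner u u).

Definition partial_sum (phi : nat -> 'rV[R]_d -> R) (c : nat -> R) (N : nat)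
    : 'rV[R]_d -> R :=
  fun x => \sum_(k < N) c k * phi k x.

(* w is the sum in L^2(Omega) of the series of the c k * phi k. *)
Definition L2_series (phi : nat -> 'rV[R]_d -> R) (c : nat -> R) w : Prop :=
  L2 w /\ (fun n => norm2 (partial_sum phi c n \- w)) @ \oo --> (0 : R).

Definition orthonormal_basis (phi : nat -> 'rV[R]_d -> R) : Prop :=
  [/\ forall k, L2 (phi k),
      forall i j, inner (phi i) (phi j) = (i == j)%:R &
      forall u, L2 u -> L2_series phi (fun k => inner u (phi k)) u].

End L2_space.

Section Sobolev.
Variables (R : realType) (d : nat).
Local Notation mu := (lebesgue_rV R d).
Implicit Types (Omega U : set 'rV[R]_d) (u v psi rho : 'rV[R]_d -> R).

Definition partial (i : 'I_d) u : 'rV[R]_d -> R :=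
  fun x => 'D_(delta_mx ord0 i : 'rV[R]_d) u x.

Definition iter_partial (s : seq 'I_d) u : 'rV[R]_d -> R :=
  foldr partial u s.

(* C^infty on the open set U: all iterated partial derivatives exist and are
   continuous on U. *)
Definition smooth_on U u : Prop :=
  forall (s : seq 'I_d) x, U x ->
    {for x, continuous (iter_partial s u)} /\
    forall i, derivable (iter_partial s u) x (delta_mx ord0 i : 'rV[R]_d).

Definition domain Omega : Prop :=
  [/\ open Omega, Omega !=set0, connected Omega & bounded_set Omega].

(* Near each of its boundary points, Omega is a strict sublevel set of a smooth
   function with nonvanishing gradient there. *)
Definition smooth_boundary Omega : Prop :=
  forall x, (closure Omega `\` Omega) x ->
    exists U rho, [/\ open U, U x, smooth_on U rho,
      exists i, partial i rho x != 0 &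
      Omega `&` U = [set y | U y /\ rho y < rho x]].

Definition test_function Omega psi : Prop :=
  [/\ smooth_on setT psi, compact (closure [set x | psi x != 0]) &
      closure [set x | psi x != 0] `<=` Omega].

Definition weak_partial Omega (i : 'I_d) u v : Prop :=
  forall psi, test_function Omega psi ->
    \int[mu]_(x in Omega) (u x * partial i psi x) =
    - \int[mu]_(x in Omega) (v x * psi x).

(* u is in H^1(Omega), with weak gradient Du. *)
Definition H1 Omega u (Du : 'I_d -> 'rV[R]_d -> R) : Prop :=
  [/\ L2 Omega u, forall i, L2 Omega (Du i) &
      forall i, weak_partial Omega i u (Du i)].

(* u is in H^2(Omega), with weak gradient Du and weak Hessian D2u. *)
Definition H2 Omega u (Du : 'I_d -> 'rV[R]_d -> R)
    (D2u : 'I_d -> 'I_d -> 'rV[R]_d -> R) : Prop :=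
  H1 Omega u Du /\ forall i, H1 Omega (Du i) (D2u i).

(* The closure of the test functions in H^1(Omega). *)
Definition H10 Omega u : Prop :=
  exists Du, H1 Omega u Du /\
  exists psi : nat -> 'rV[R]_d -> R,
    [/\ forall n, test_function Omega (psi n),
        (fun n => norm2 Omega (psi n \- u)) @ \oo --> (0 : R) &
        forall i,
        (fun n => norm2 Omega (partial i (psi n) \- Du i)) @ \oo --> (0 : R)].

Definition H2H10 Omega u : Prop :=
  (exists Du D2u, H2 Omega u Du D2u) /\ H10 Omega u.

(* L is a second order operator with bounded measurable coefficients; -L is
   uniformly elliptic, and L is symmetric on H^2 /\ H^1_0. *)
Definition symmetric_uniformly_elliptic Omega
    (L : ('rV[R]_d -> R) -> 'rV[R]_d -> R) : Prop :=
  (exists (a : 'I_d -> 'I_d -> 'rV[R]_d -> R) (b : 'I_d -> 'rV[R]_d -> R)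
          (c : 'rV[R]_d -> R) (theta M : R),
    [/\ [/\ forall i j, measurable_fun Omega (a i j),
            forall i, measurable_fun Omega (b i) &
            measurable_fun Omega c],
        forall x, Omega x ->
          [/\ forall i j, `|a i j x| <= M, forall i, `|b i x| <= M &
              `|c x| <= M],
        forall x, Omega x -> forall i j, a i j x = a j i x,
        0 < theta /\ (forall x, Omega x -> forall xi : 'rV[R]_d,
          theta * (\sum_i xi ord0 i ^+ 2) <=
          \sum_i \sum_j a i j x * xi ord0 i * xi ord0 j) &
        forall u Du D2u, H2 Omega u Du D2u -> H10 Omega u ->
          ae_eq_on Omega (L u) (fun x =>
            \sum_i \sum_j a i j x * D2u i j x + \sum_i b i x * Du i x
            + c x * u x)]) /\
  (forall u v, H2H10 Omega u -> H2H10 Omega v ->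
     inner Omega (L u) v = inner Omega u (L v)).

(* The sequences are indexed from 0: lam k and phi k are the (k+1)-st
   eigenvalue and eigenfunction. *)
Definition eigensystem Omega (L : ('rV[R]_d -> R) -> 'rV[R]_d -> R)
    (lam : nat -> R) (phi : nat -> 'rV[R]_d -> R) : Prop :=
  [/\ forall k, H2H10 Omega (phi k) /\
        ae_eq_on Omega (\- L (phi k)) (fun x => lam k * phi k x),
      0 < lam 0%N, {homo lam : m n / (m <= n)%N >-> m <= n},
      lam @ \oo --> +oo & orthonormal_basis Omega phi].

End Sobolev.

Section Kilbas_Saigo.
Variable R : realType.

Definition Gamma (s : R) : R :=
  \int[lebesgue_measure]_(t in `]0, +oo[) (t `^ (s - 1) * expR (- t)).

Definition kilbas_saigo (a m n z : R) : R :=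
  limn (series (fun k => (\prod_(j < k)
    (Gamma (a * (j%:R * m + n) + 1) / Gamma (a * (j%:R * m + n + 1) + 1)))
    * z ^+ k)).

Definition eta2 (alpha beta : R) : R :=
  Gamma (1 + beta) / Gamma (1 + alpha + beta).

Definition e_ (alpha beta l lam : R) : R :=
  kilbas_saigo alpha (1 + beta / alpha) (beta / alpha)
    (- (Num.sqrt lam * l `^ (alpha + beta))).

Definition sigma_ (alpha beta l lam : R) : R :=
  eta2 alpha beta / Num.sqrt lam * l `^ (alpha + beta) *
  kilbas_saigo alpha (1 + beta / alpha) (1 + 2 * beta / alpha)
    (- (Num.sqrt lam * l `^ (alpha + beta))).

End Kilbas_Saigo.

Section Inverse_source.
Variables (R : realType) (d : nat) (Omega : set 'rV[R]_d).
Variables (phi : nat -> 'rV[R]_d -> R) (lam : nat -> R).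
Variables (alpha beta l : R).
Local Notation coef u k := (inner Omega u (phi k)).
Local Notation ek k := (e_ alpha beta l (lam k)).
Local Notation sk k := (sigma_ alpha beta l (lam k)).
Implicit Types f g h hdelta v w : 'rV[R]_d -> R.

(* w = K v, as an identity in L^2(Omega). *)
Definition is_K v w : Prop :=
  L2_series Omega phi (fun k => sk k * coef v k) w.

Definition truncation v (N : nat) : 'rV[R]_d -> R :=
  partial_sum phi (fun k => coef v k) N.

Definition exact_trace f g h : Prop :=
  exists F Kg, [/\ L2_series Omega phi (fun k => coef f k * ek k) F,
                   is_K g Kg & h = F \- Kg].

Definition noisy_data f hdelta (N : nat) : 'rV[R]_d -> R :=
  partial_sum phi (fun k => coef f k * ek k) N \- hdelta.

Definition noisy_coef f hdelta (k : nat) : R :=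
  coef f k * ek k - coef hdelta k.

Definition regularized_solution (r tau : R) f hdelta (N : nat)
    : 'rV[R]_d -> R :=
  partial_sum phi (fun k =>
    (sk k + tau * expR (lam k `^ r))^-1 * noisy_coef f hdelta k) N.

Definition discrepancy_principle (r tau rho delta : R) f hdelta (N : nat)
    : Prop :=
  exists2 w, is_K (regularized_solution r tau f hdelta N) w &
    norm2 Omega (w \- noisy_data f hdelta N) = rho * delta.

End Inverse_source.

(* M bounds the noise range on which the error constant is claimed to be
   uniform: every delta > 0 is admissible once rho is at least 1 + 1/M, every
   rho > 1 is admissible once delta is at most M, and for p >= 2 nothing is
   excluded.  For p < 2 no constant is uniform in the remaining corner, where
   delta tends to infinity while rho tends to 1: components of the noise of
   norm of order sqrt delta on phi_1, .., phi_N are compatible with the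
   discrepancy principle (with tau = 1 and a suitable rho > 1) as soon as h has
   a nonzero coefficient of index > N.  They produce an error of order
   sqrt delta, which exceeds every multiple of delta^(p/(p+2)). *)
Definition noise_range (R : realType) (M p delta rho : R) : Prop :=
  [\/ delta <= M, 1 + M^-1 <= rho | 2 <= p].

(* Main.v *)
(* Put [gamma = alpha + beta], and let [w x] be the power series in [- x^gamma]
   that defines [e_] at eigenvalue 1.  It solves the Volterra equation
     w x = 1 - 1/Gamma(alpha) * int_0^x (x - t)^(alpha - 1) t^beta w t dt.
   Because the kernel decreases in [x], [w] has no first zero; hence [0 < w] on
   [0, +oo[ and then [w < 1] on ]0, +oo[.  As [sigma_ = (1 - w x) / lam] for the
   [x] with [x^gamma = sqrt lam * l^gamma], every [sigma_] is positive.
   The coefficients of K (gtilde - g_N) on phi_0, .., phi_(N-1) are those of the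
   residual minus those of the noise, so they are at most [(1 + rho) * delta];
   dividing by the finitely many [sigma_] gives an error linear in
   [X = (1 + rho) * delta].  This is enough where [X] stays bounded.  Otherwise
   [2 <= p], and expanding the square of the residual shows that the error is
   [O (sqrt X)], which [X^(p/(p+2))] dominates. *)
Require Import Defs.
From mathcomp Require Import all_boot all_order all_algebra.
From mathcomp Require Import all_classical all_reals all_analysis.
From mathcomp Require Import measurable_realfun.
From mathcomp Require Import ring lra.
Import Order.TTheory GRing.Theory Num.Theory.
Import numFieldNormedType.Exports.
Local Open Scope classical_set_scope.
Local Open Scope ring_scope.

(** * The space L^2(Omega) *)

Section L2_theory.
Context (R : realType) (d : nat) (Omega : set 'rV[R]_d).
Local Notation mu := (lebesgue_rV R d).
Local Notation fn := ('rV[R]_d -> R).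
Local Notation L2 := (L2 Omega).
Local Notation inner := (inner Omega).
Local Notation norm2 := (norm2 Omega).
Implicit Types u v w : fn.

Lemma L2D u v : L2 u -> L2 v -> L2 (u \+ v).
Proof.
rewrite /Defs.L2 => Lu Lv.
rewrite (_ : _ \_ _ = u \_ Omega + v \_ Omega); last first.
  by apply/funext => x; rewrite patchE/= !fctE !patchE; case: ifP; rewrite ?addr0.
by rewrite rpredD// lee1n.
Qed.

Lemma L2Z (a : R) u : L2 u -> L2 (fun x => a * u x).
Proof.
rewrite /Defs.L2 => Lu.
rewrite (_ : _ \_ _ = a \o* (u \_ Omega)); last first.
  apply/funext => x; rewrite patchE/= !patchE; case: ifP => _; rewrite ?mul0r//.
  by rewrite mulrC.
by apply: Lfun_scale => //; rewrite ler1n.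
Qed.

Lemma L2_cst0 : L2 (fun=> 0).
Proof.
rewrite /Defs.L2 (_ : _ \_ _ = 0) ?rpred0 ?lee1n//.
by apply/funext => x; rewrite patchE; case: ifP.
Qed.

Lemma L2N u : L2 u -> L2 (\- u).
Proof.
move=> Lu; rewrite (_ : \- u = fun x => -1 * u x); first exact: L2Z.
by apply/funext => x/=; rewrite mulN1r.
Qed.

Lemma L2B u v : L2 u -> L2 v -> L2 (u \- v).
Proof. by move=> Lu Lv; apply: L2D => //; exact: L2N. Qed.

(** Zero extensions to all of R^d make the integrability of products of [Lfun] functions
    available. *)
Lemma innerE u v : inner u v = \int[mu]_x ((u \_ Omega) x * (v \_ Omega) x).
Proof.
rewrite /Defs.inner Rintegral_mkcond; apply: eq_Rintegral => x _.
by rewrite !patchE; case: ifP; rewrite ?mulr0.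
Qed.

Let integrable_inner u v : L2 u -> L2 v ->
  mu.-integrable setT (EFin \o (fun x => (u \_ Omega) x * (v \_ Omega) x)).
Proof. by move=> Lu Lv; apply/Lfun1_integrable/Lfun2_mul_Lfun1. Qed.

Lemma innerC u v : inner u v = inner v u.
Proof. by rewrite !innerE; apply: eq_Rintegral => x _; rewrite mulrC. Qed.

Lemma innerDl u v w : L2 u -> L2 v -> L2 w ->
  inner (u \+ v) w = inner u w + inner v w.
Proof.
move=> Lu Lv Lw; rewrite !innerE -RintegralD//; try exact: integrable_inner.
(* Off [Omega] the patched functions take the default [point], which is the 0 of [R]; [ring] needs
   it in that form. *)
by apply: eq_Rintegral => x _; rewrite !patchE; case: ifP => _ /=;
  rewrite -?[point]/(0 : R); ring.
Qed.

Lemma innerZl (a : R) u v : L2 u -> L2 v ->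
  inner (fun x => a * u x) v = a * inner u v.
Proof.
move=> Lu Lv; rewrite !innerE -RintegralZl//; last exact: integrable_inner.
by apply: eq_Rintegral => x _; rewrite !patchE; case: ifP => _ /=;
  rewrite -?[point]/(0 : R); ring.
Qed.

Lemma innerBl u v w : L2 u -> L2 v -> L2 w ->
  inner (u \- v) w = inner u w - inner v w.
Proof.
move=> Lu Lv Lw; rewrite (_ : u \- v = u \+ (fun x => -1 * v x)); last first.
  by apply/funext => x/=; rewrite mulN1r.
by rewrite innerDl ?innerZl ?mulN1r//; exact: L2Z.
Qed.

Lemma innerBr u v w : L2 u -> L2 v -> L2 w ->
  inner u (v \- w) = inner u v - inner u w.
Proof. by move=> *; rewrite innerC innerBl// 2!(innerC u). Qed.

Lemma inner_ge0 u : 0 <= inner u u.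
Proof. by apply: Rintegral_ge0 => x _; rewrite -expr2 sqr_ge0. Qed.

Lemma sqr_norm2 u : norm2 u ^+ 2 = inner u u.
Proof. by rewrite /Defs.norm2 sqr_sqrtr// inner_ge0. Qed.

Lemma norm2_ge0 u : 0 <= norm2 u.
Proof. exact: sqrtr_ge0. Qed.

Lemma norm2_subC u v : norm2 (u \- v) = norm2 (v \- u).
Proof.
rewrite /Defs.norm2 !innerE; congr Num.sqrt; apply: eq_Rintegral => x _.
by rewrite !patchE; case: ifP => _ /=;
  rewrite -?[point]/(0 : R); ring.
Qed.

(** The polynomial t -> (u - t v, u - t v) is nonnegative; taking t = (u, v) / (v, v) gives the
    inequality. *)
Lemma Cauchy_Schwarz u v : L2 u -> L2 v -> `|inner u v| <= norm2 u * norm2 v.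
Proof.
move=> Lu Lv.
have quad (t : R) : 0 <= inner u u - 2 * t * inner u v + t ^+ 2 * inner v v.
  have Ltv := L2Z t v Lv.
  have := inner_ge0 (u \- (fun x => t * v x)).
  rewrite innerBl ?innerBr//; [|exact: L2B].
  rewrite (innerC u (fun x => t * v x)) !innerZl// (innerC v (fun x => t * v x)).
  by rewrite innerZl// (innerC v u) (_ : _ - _ - _ = inner u u - 2 * t * inner u v
     + t ^+ 2 * inner v v) //; ring.
rewrite -ler_sqr ?nnegrE// ?mulr_ge0 ?norm2_ge0// exprMn !sqr_norm2.
rewrite -normrX ger0_norm ?sqr_ge0//.
have := inner_ge0 v; rewrite le_eqVlt => /predU1P[v0|v0]; last first.
  have := mulr_ge0 (quad (inner u v / inner v v)) (ltW v0).
  rewrite (_ : (_ + _) * _ = inner u u * inner v v - inner u v ^+ 2) ?subr_ge0//.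
  by field; rewrite gt_eqF.
(* If (v, v) = 0, the polynomial is affine in t; were (u, v) nonzero, the t chosen below would give
   it the value -1. *)
rewrite -v0 mulr0; have [->|uv0] := eqVneq (inner u v) 0; first by rewrite expr0n.
have := quad ((inner u u + 1) / (2 * inner u v)).
rewrite -v0 mulr0 addr0 (_ : 2 * _ * _ = inner u u + 1); last by field.
lra.
Qed.

Lemma norm2D u v : L2 u -> L2 v -> norm2 (u \+ v) <= norm2 u + norm2 v.
Proof.
move=> Lu Lv; rewrite -ler_sqr ?nnegrE ?addr_ge0 ?norm2_ge0//.
have Luv := L2D u v Lu Lv.
rewrite sqrrD !sqr_norm2 innerDl// 2![inner _ (_ \+ _)]innerC !innerDl//.
have := Cauchy_Schwarz u v Lu Lv; have := ler_norm (inner u v).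
rewrite (innerC v u); lra.
Qed.

Lemma norm2B u v : L2 u -> L2 v -> norm2 (u \- v) <= norm2 u + norm2 v.
Proof.
move=> Lu Lv; rewrite -ler_sqr ?nnegrE ?addr_ge0 ?norm2_ge0//.
have Luv := L2B u v Lu Lv.
rewrite sqrrD !sqr_norm2 innerBl// !innerBr//.
have := Cauchy_Schwarz u v Lu Lv; have := ler_norm (- inner u v).
rewrite normrN (innerC v u); lra.
Qed.

Lemma norm2_triangle u v w : L2 u -> L2 v -> L2 w ->
  norm2 (u \- w) <= norm2 (u \- v) + norm2 (v \- w).
Proof.
move=> Lu Lv Lw; apply: le_trans (norm2D _ _ (L2B _ _ Lu Lv) (L2B _ _ Lv Lw)).
by rewrite (_ : u \- w = (u \- v) \+ (v \- w))//; apply/funext => x /=; ring.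
Qed.

(** * Finite orthonormal sums and coefficients of L^2 series *)

Section orthonormal.
Variable phi : nat -> fn.
Hypothesis Lphi : forall k, L2 (phi k).
Hypothesis on_phi : forall i j, inner (phi i) (phi j) = (i == j)%:R.
Implicit Types (c e : nat -> R) (n k : nat).
Local Notation S := (partial_sum phi).

Lemma partial_sumS c n : S c n.+1 = S c n \+ (fun x => c n * phi n x).
Proof. by apply/funext => x; rewrite /partial_sum big_ord_recr. Qed.

Lemma L2_partial_sum c n : L2 (S c n).
Proof.
elim: n => [|n ih]; last by rewrite partial_sumS; apply: L2D => //; exact: L2Z.
rewrite (_ : S c 0 = fun=> 0); first exact: L2_cst0.
by apply/funext => x; rewrite /partial_sum big_ord0.
Qed.

Lemma inner_partial_suml c n u : L2 u ->
  inner (S c n) u = \sum_(k < n) c k * inner (phi k) u.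
Proof.
move=> Lu; elim: n => [|n ih].
  rewrite big_ord0 (_ : S c 0 = fun x => 0 * u x) ?innerZl ?mul0r//.
  by apply/funext => x; rewrite /partial_sum big_ord0 mul0r.
rewrite partial_sumS innerDl//; [|exact: L2_partial_sum|exact: L2Z].
by rewrite ih innerZl// big_ord_recr.
Qed.

Lemma coef_partial_sum c n k :
  inner (S c n) (phi k) = if (k < n)%N then c k else 0.
Proof.
rewrite inner_partial_suml//; under eq_bigr do rewrite on_phi.
case: ifPn => kn.
  rewrite (bigD1 (Ordinal kn))//= eqxx mulr1 big1 ?addr0// => i ik.
  by rewrite (negbTE (_ : _ != _)) ?mulr0//; apply: contra_neq ik => ?; exact/val_inj.
rewrite big1// => i _; rewrite (negbTE (_ : _ != _)) ?mulr0//.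
by apply: contraNneq kn => <-.
Qed.

Lemma inner_partial_sums c e n :
  inner (S c n) (S e n) = \sum_(k < n) c k * e k.
Proof.
rewrite inner_partial_suml; last exact: L2_partial_sum.
by apply: eq_bigr => k _; rewrite innerC coef_partial_sum ltn_ord.
Qed.

(** The square is completed in each coefficient separately, so that the residual can be compared
    with [norm2 u] term by term. *)
Lemma sqr_norm2_partial_sumB c n u : L2 u ->
  norm2 (S c n \- u) ^+ 2 =
  \sum_(k < n) ((c k - inner u (phi k)) ^+ 2 - inner u (phi k) ^+ 2) + norm2 u ^+ 2.
Proof.
move=> Lu; have LS := L2_partial_sum c n.
rewrite !sqr_norm2 innerBl ?innerBr//; last exact: L2B.
rewrite (innerC u) inner_partial_sums inner_partial_suml//.
rewrite opprB addrA addrAC; congr (_ + _).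
rewrite -!sumrB; apply: eq_bigr => k _; rewrite (innerC (phi k)); ring.
Qed.

Lemma coef_le_norm2 k u : L2 u -> `|inner u (phi k)| <= norm2 u.
Proof.
move=> Lu; apply: le_trans (Cauchy_Schwarz _ _ Lu (Lphi k)) _.
by rewrite [norm2 (phi k)]/Defs.norm2 on_phi eqxx sqrtr1 mulr1.
Qed.

(** Taking a coefficient is bounded by the norm, and the k-th coefficient of a partial sum is [c k]
    once its length exceeds k. *)
Lemma coef_L2_series c w : L2_series Omega phi c w ->
  forall k, inner w (phi k) = c k.
Proof.
move=> [Lw cw] k; apply/eqP; rewrite -subr_eq0 -normr_le0.
apply: (ler_cvg_to (cvg_cst _) cw); near=> n.
apply: le_trans (coef_le_norm2 k _ (L2B _ _ (L2_partial_sum c n) Lw)).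
rewrite innerBl//; last exact: L2_partial_sum.
have kn : (k < n)%N by near: n; exact: nbhs_infty_gt.
by rewrite coef_partial_sum kn distrC.
Unshelve. all: by end_near. Qed.

(** A crude l^1 bound, sufficient because the constants may depend on the number of terms. *)
Lemma norm2_partial_sum c n : norm2 (S c n) <= \sum_(k < n) `|c k|.
Proof.
elim: n => [|n ih].
  rewrite big_ord0 -sqrtr0 /Defs.norm2; apply: ler_wsqrtr.
  by rewrite inner_partial_sums big_ord0.
rewrite partial_sumS big_ord_recr/=.
apply: le_trans (norm2D _ _ (L2_partial_sum c n) (L2Z _ _ (Lphi n))) _.
rewrite lerD// /Defs.norm2 innerZl//; last exact: L2Z.
by rewrite innerC innerZl// on_phi eqxx mulr1 -expr2 sqrtr_sqr.
Qed.

(** The partial sums are constant from n on, so their distance to w equals its limit 0. The sum w is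
    only determined almost everywhere, hence a statement about norms. *)
Lemma L2_series_finite c n w : (forall k, (n <= k)%N -> c k = 0) ->
  L2_series Omega phi c w -> norm2 (S c n \- w) = 0.
Proof.
move=> c0 [Lw]; rewrite -(cvg_shiftn n).
rewrite (_ : (fun m => _) = fun=> norm2 (S c n \- w)).
  by move/cvg_lim => <-//; rewrite lim_cst.
apply/funext => m; congr norm2; apply/funext => x /=; congr (_ - _).
rewrite /partial_sum -!(big_mkord xpredT (fun k => c k * phi k x)).
rewrite (big_cat_nat (n := n)) ?leq_addl//= [X in _ + X]big1_seq ?addr0// => k.
by rewrite mem_index_iota => /andP[_ /andP[nk _]]; rewrite c0// mul0r.
Qed.

End orthonormal.
End L2_theory.

(** * The Gamma and Beta integrals *)

Section affine_change_of_variable.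
Context (R : realType).
Local Notation mu := (@lebesgue_measure R).
Implicit Types (a b : R) (f : R -> \bar R).

Let affine a b : measurableTypeR R -> measurableTypeR R := fun x => a * x + b.

Let measurable_affine a b : measurable_fun setT (affine a b).
Proof. by apply: measurable_funD => //; exact: measurable_funM. Qed.

(** Lebesgue measure is determined by its values on the intervals ]u, v]; the preimage of such an
    interval has length (v - u) / a. *)
Lemma lebesgue_measure_affine a b (A : set R) (a0 : 0 < a) : measurable A ->
  pushforward (mscale (NngNum (ltW a0)) mu) (affine a b) A = mu A.
Proof.
move=> mA; apply/esym/lebesgue_measure_unique => //= _ [[u v]] _ <-.
rewrite /mscale/= /pushforward/=.
rewrite (_ : _ @^-1` _ = `](u - b) / a, (v - b) / a]%classic); last first.
  apply/seteqP; split => x /=; rewrite !in_itv/= ltr_pdivrMr// ler_pdivlMr//;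
  by rewrite ltrBlDr lerBrDr mulrC.
rewrite !lebesgue_measure_itv/= !lte_fin ltr_pM2r ?invr_gt0// ltrD2r.
case: ifPn => _; last by rewrite mule0.
by rewrite -!EFinB -EFinM; congr EFin; field; rewrite gt_eqF.
Qed.

Lemma ge0_integral_affine a b f : 0 < a -> measurable_fun [set: R] f ->
  (forall x, (0 <= f x)%E) ->
  (\int[mu]_x f x = a%:E * \int[mu]_x f (a * x + b)%R)%E.
Proof.
move=> a0 mf f0; rewrite -(ge0_integral_mscale _ _ (NngNum (ltW a0)))//; last first.
  exact: measurableT_comp (measurable_affine a b).
rewrite -[X in _ = integral _ X _]/(affine a b @^-1` setT).
rewrite -(ge0_integral_pushforward (measurable_affine a b) _ _ mf)//.
by apply: eq_measure_integral => //= A mA _; exact/esym/lebesgue_measure_affine.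
Qed.

End affine_change_of_variable.

(** * Convolutions of truncated powers and products of Gamma integrals *)

Section truncated_power.
Context (R : realType).
Local Notation mu := (@lebesgue_measure R).
Implicit Types (a b s t x y : R).

(* [powR] takes the value 1 at negative bases; cutting it off makes convolutions
   over R agree with the integrals over [0, x]. *)
Definition ppow s t : R := if 0 < t then t `^ s else 0.

Lemma ppow_ge0 s t : 0 <= ppow s t.
Proof. by rewrite /ppow; case: ifP => // _; exact: powR_ge0. Qed.

Lemma ppowE s t : 0 < t -> ppow s t = t `^ s.
Proof. by rewrite /ppow => ->. Qed.

Lemma ppow_le0 s t : t <= 0 -> ppow s t = 0.
Proof. by rewrite /ppow ltNge => ->. Qed.

Lemma ppow_affine s a t : 0 < a -> ppow s (a * t) = a `^ s * ppow s t.
Proof.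
move=> a0; rewrite /ppow pmulr_rgt0//; case: ifPn => t0; last by rewrite mulr0.
by rewrite powRM// ltW.
Qed.

Lemma measurable_ppow s : measurable_fun [set: R] (ppow s).
Proof.
have pos : measurable_fun [set: R] (fun t => 0 < t) by apply: measurable_fun_ltr.
exact: (measurable_fun_ifT pos (measurable_powR s)).
Qed.

Lemma measurable_ppow_sub s x : measurable_fun [set: R] (fun t => ppow s (x - t)).
Proof.
apply: (measurableT_comp (measurable_ppow s)).
exact: measurable_funB.
Qed.

(** At x = 1 this is Euler's integral B(a + 1, b + 1). It is extended-real valued because its
    finiteness is only derived later. *)
Definition conv_ppow a b x : \bar R := (\int[mu]_t (ppow a (x - t) * ppow b t)%:E)%E.

Lemma measurable_conv_ppow a b x :
  measurable_fun [set: R] (fun t => ppow a (x - t) * ppow b t).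
Proof.
by apply: measurable_funM; [exact: measurable_ppow_sub|exact: measurable_ppow].
Qed.

(** For x > 0, substitute x t for t. For x <= 0, t and x - t are never both positive, so both sides
    vanish. *)
Lemma conv_ppowE a b x :
  (conv_ppow a b x = (ppow (a + b + 1) x)%:E * conv_ppow a b 1)%E.
Proof.
have [x0|x0] := leP x 0.
  rewrite ppow_le0// mul0e /conv_ppow integral0_eq// => t _.
  have [t0|t0] := leP t 0; first by rewrite [ppow b t]ppow_le0// mulr0.
  by rewrite ppow_le0 ?mul0r// subr_le0 (le_trans x0)// ltW.
have mf : measurable_fun [set: R] (fun t => (ppow a (x - t) * ppow b t)%:E).
  by apply/measurable_EFinP; exact: measurable_conv_ppow.
have f0 t : (0 <= (ppow a (x - t) * ppow b t)%:E)%E.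
  by rewrite lee_fin mulr_ge0// ppow_ge0.
rewrite {1}/conv_ppow (ge0_integral_affine R x 0 _ x0 mf f0).
have -> : ppow (a + b + 1) x = x * (x `^ a * x `^ b).
  have xN0 (u v : R) : (u + v == 0) ==> (x != 0) by rewrite (gt_eqF x0) implybT.
  by rewrite ppowE// (powRD (xN0 (a + b) 1)) (powRD (xN0 a b)) powRr1 ?ltW// mulrC.
rewrite EFinM -muleA; congr (_ * _)%E.
rewrite -ge0_integralZl_EFin ?mulr_ge0 ?powR_ge0//; last 2 first.
- by move=> t _; rewrite lee_fin mulr_ge0// ppow_ge0.
- by apply/measurable_EFinP; exact: measurable_conv_ppow.
apply: eq_integral => t _; rewrite -EFinM; congr EFin.
rewrite addr0 (_ : x - x * t = x * (1 - t)); last by ring.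
by rewrite !ppow_affine//; ring.
Qed.

(** Euler's integral for Gamma(s + 1), in the extended reals so that Tonelli applies before
    finiteness is known. *)
Definition eGamma s : \bar R := (\int[mu]_t (ppow s t * expR (- t))%:E)%E.

Lemma measurable_eGamma s : measurable_fun [set: R] (fun t => ppow s t * expR (- t)).
Proof.
by apply: measurable_funM; [exact: measurable_ppow|exact: measurableT_comp].
Qed.

Lemma eGamma_ge0 s : (0 <= eGamma s)%E.
Proof. by apply: integral_ge0 => t _; rewrite lee_fin mulr_ge0 ?ppow_ge0 ?expR_ge0. Qed.

Lemma Gamma_eGamma s : Gamma s = fine (eGamma (s - 1)).
Proof.
rewrite /Gamma Rintegral_mkcond /eGamma; congr fine.
apply: eq_integral => t _; rewrite patchE /ppow; congr EFin.
by rewrite mem_setE /= in_itv/= andbT; case: ifP; rewrite ?mul0r.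
Qed.

(** In the double integral the second variable is translated to the sum y of both. The exponential
    then depends on y alone, and after Tonelli the inner integral is the convolution at y. *)
Lemma eGammaM a b : (eGamma b * eGamma a = eGamma (a + b + 1) * conv_ppow a b 1)%E.
Proof.
pose H (z : R * R) : \bar R := (ppow a (z.2 - z.1) * ppow b z.1 * expR (- z.2))%:E.
have H0 z : (0 <= H z)%E by rewrite lee_fin !mulr_ge0 ?ppow_ge0 ?expR_ge0.
have mH : measurable_fun setT H.
  apply/measurable_EFinP; apply: measurable_funM.
    apply: measurable_funM.
      by apply: (measurableT_comp (measurable_ppow a)); exact: measurable_funB.
    exact: (measurableT_comp (measurable_ppow b)).
  by apply: measurableT_comp => //; exact: measurableT_comp.
transitivity (\int[mu]_t \int[mu]_y H (t, y))%E.
  rewrite -ge0_integralZr//; last 3 first.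
  - by apply/measurable_EFinP; exact: measurable_eGamma.
  - by move=> t _; rewrite lee_fin mulr_ge0 ?ppow_ge0 ?expR_ge0.
  - exact: eGamma_ge0.
  apply: eq_integral => t _.
  rewrite {1}/eGamma (ge0_integral_affine _ 1 (- t))//; last 2 first.
  - by apply/measurable_EFinP; exact: measurable_eGamma.
  - by move=> y; rewrite lee_fin mulr_ge0 ?ppow_ge0 ?expR_ge0.
  rewrite mul1e -ge0_integralZl_EFin ?mulr_ge0 ?ppow_ge0 ?expR_ge0//; last 2 first.
  - by move=> y _; rewrite lee_fin mulr_ge0 ?ppow_ge0 ?expR_ge0.
  - apply/measurable_EFinP; apply: (measurableT_comp (measurable_eGamma a)).
    exact: measurable_funD.
  apply: eq_integral => y _; rewrite /H/= -EFinM; congr EFin.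
  rewrite mul1r (_ : - y = - t - (y - t)); last by ring.
  by rewrite expRD; ring.
rewrite (@fubini_tonelli _ _ _ _ _ mu mu H mH H0) -ge0_integralZr//; last 3 first.
- by apply/measurable_EFinP; exact: measurable_eGamma.
- by move=> t _; rewrite lee_fin mulr_ge0 ?ppow_ge0 ?expR_ge0.
- by apply: integral_ge0 => t _; rewrite lee_fin mulr_ge0 ?ppow_ge0.
apply: eq_integral => y _; rewrite EFinM muleAC -conv_ppowE.
rewrite muleC -ge0_integralZl_EFin ?expR_ge0//; last 2 first.
- by move=> t _; rewrite lee_fin mulr_ge0// ppow_ge0.
- by apply/measurable_EFinP; exact: measurable_conv_ppow.
by apply: eq_integral => t _; rewrite /H/= mulrC EFinM.
Qed.

End truncated_power.

Arguments ppow {R} s t.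
Arguments conv_ppow {R} a b x.
Arguments eGamma {R} s.

(** * Finiteness and positivity of Gamma, and the Beta integral *)

Section Beta_integral.
Context (R : realType).
Local Notation mu := (@lebesgue_measure R).
Implicit Types (a b s t x y : R).

(** The fundamental theorem of calculus on intervals exhausting ]0, 1], followed by monotone
    convergence. *)
Lemma integral_powR_itv01 a : 0 < a ->
  (\int[mu]_(x in `]0%R, 1%R]) (x `^ (a - 1))%:E <= (a^-1)%:E)%E.
Proof.
move=> a0.
(* With [n.+2] the left endpoint is strictly below 1 for every n, so each interval is
   nondegenerate. *)
pose F n : set R := `[(n.+2%:R^-1), 1]%classic.
have F_gt0 n x : F n x -> 0 < x.
  by rewrite /F/= in_itv/= => /andP[+ _]; apply: lt_le_trans.
have -> : `]0%R, 1%R]%classic = \bigcup_n F n.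
  apply/seteqP; split => x /=; last first.
    move=> [n _ /[dup] /F_gt0]; rewrite /F/= !in_itv/= => -> /andP[_ ->] //.
  rewrite in_itv/= => /andP[x0 x1]; exists (Num.truncn x^-1) => //.
  rewrite /F/= in_itv/= x1 andbT -[leRHS]invrK lef_pV2 ?posrE ?invr_gt0//.
  by rewrite (le_trans (ltW (truncnS_gt _)))// ler_nat.
have mf : measurable_fun [set: R] (fun x => (x `^ (a - 1))%:E).
  by apply/measurable_EFinP; exact: measurable_powR.
have F_le n : (\int[mu]_(x in F n) (x `^ (a - 1))%:E <= (a^-1)%:E)%E.
  have n2 : n.+2%:R^-1 < 1 :> R by rewrite invf_lt1// ltr1n.
  have cp b x : 0 < x -> {for x, continuous (fun x : R => x `^ b)}.
    move=> x0; apply/differentiable_continuous/derivable1_diffP.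
    by apply: derivable_powR; rewrite in_itv/= andbT.
  rewrite (@continuous_FTC2 _ _ (fun x => a^-1 * x `^ a))//.
  - rewrite -EFinB lee_fin powR1 mulr1 lerBlDr lerDl mulr_ge0 ?powR_ge0//.
    by rewrite invr_ge0 ltW.
  - apply: continuous_in_subspaceT => x /set_mem /F_gt0; exact: cp.
  - have ca x : 0 < x -> {for x, continuous (fun x : R => a^-1 * x `^ a)}.
      by move=> x0; apply: cvgM; [exact: cvg_cst|exact: cp].
    split; last 2 first.
    + by apply: cvg_at_right_filter; apply: ca.
    + by apply: cvg_at_left_filter; exact: ca.
    + move=> x; rewrite in_itv/= => /andP[nx _].
      apply: derivableM => //; apply: derivable_powR; rewrite in_itv/= andbT.
      by rewrite (lt_trans _ nx).
  - move=> x; rewrite in_itv/= => /andP[nx _].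
    have x0 : 0 < x by rewrite (lt_trans _ nx).
    rewrite derive1Ml ?powR_derive1 ?in_itv/= ?andbT//; last first.
      by apply: derivable_powR; rewrite in_itv/= andbT.
    by rewrite mulKf// gt_eqF.
apply: (cvge_le (nearW _ F_le) (ge0_nondecreasing_set_cvg_integral _ _ _ _)) => //.
- move=> m n mn; apply/subsetPset => x; rewrite /F/= !in_itv/= => /andP[mx ->].
  by rewrite andbT (le_trans _ mx)// lef_pV2 ?posrE// ler_nat !ltnS.
- by move=> n; exact: measurable_itv.
- by move=> n; exact: measurable_funTS.
- by move=> n x _; rewrite lee_fin powR_ge0.
Qed.

(** Half of the exponential absorbs the power: ln(t/k) <= t/k and s/k <= 1/2 give t^s exp(-t/2) <=
    k^s. What remains is a multiple of the exponential density of rate 1/2. *)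
Let eGamma_ge0_lty s : 0 <= s -> (eGamma s < +oo)%E.
Proof.
move=> s0.
pose k : R := 2 * (s + 1).
have k0 : 0 < k by rewrite mulr_gt0// ltr_wpDl.
pose C : R := k `^ s * 2.
have half0 : (0 : R) < 2^-1 by rewrite invr_gt0.
apply: (@le_lt_trans _ _ (\int[mu]_t (C%:E * (exponential_pdf 2^-1 t)%:E))%E).
  apply: ge0_le_integral => //.
  - by move=> t _; rewrite lee_fin mulr_ge0 ?ppow_ge0 ?expR_ge0.
  - by apply/measurable_EFinP; exact: measurable_eGamma.
  - apply: measurable_funeM; apply/measurable_EFinP.
    exact: measurable_exponential_pdf.
  move=> t _; rewrite -EFinM lee_fin.
  have [t0|t0] := leP t 0.
    rewrite ppow_le0// mul0r mulr_ge0 ?mulr_ge0 ?powR_ge0//.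
    by apply: exponential_pdf_ge0; exact: ltW.
  rewrite exponential_pdfE ?(ltW t0)// ppowE// /C -mulrA.
  rewrite [2 * _]mulrA divff ?mul1r ?pnatr_eq0//.
  rewrite (_ : - t = - 2^-1 * t + (- 2^-1 * t)); last by field.
  rewrite expRD mulrA ler_pM2r ?expR_gt0//.
  rewrite mulNr expRN ler_pdivrMr ?expR_gt0//.
  rewrite /powR !gt_eqF// -expRD ler_expR.
  have := ltW (ln_sublinear (divr_gt0 t0 k0)); rewrite ln_div ?posrE// => h.
  rewrite -lerBlDl -mulrBr (le_trans (ler_wpM2l s0 h))//.
  rewrite mulrA ler_pdivrMr// (_ : _ * k = s * t + t); last by rewrite /k; field.
  by rewrite lerDl ltW.
rewrite ge0_integralZl_EFin //; last 3 first.
- by move=> t _; rewrite lee_fin exponential_pdf_ge0// ltW.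
- by apply/measurable_EFinP; exact: measurable_exponential_pdf.
- by rewrite mulr_ge0 ?powR_ge0.
by rewrite integral_exponential_pdf// mule1 ltry.
Qed.

(** For negative s the integrand is at most t^s on ]0, 1] and at most exp(-t) beyond 1; [p] and [q]
    are these two majorants. *)
Lemma eGamma_lty s : -1 < s -> (eGamma s < +oo)%E.
Proof.
move=> s1; have [|s0] := leP 0 s; first exact: eGamma_ge0_lty.
pose p := (fun x : R => (x `^ s)%:E) \_ `]0%R, 1%R].
have p0 t : (0 <= p t)%E by rewrite /p patchE; case: ifP => // _; rewrite lee_fin powR_ge0.
have mp : measurable_fun [set: R] p.
  rewrite /p; apply: (measurable_restrictT _ _).1 => //; apply: measurable_funTS.
  by apply/measurable_EFinP; exact: measurable_powR.
pose q (t : R) : \bar R := (ppow 0 t * expR (- t))%:E.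
have q0 t : (0 <= q t)%E by rewrite lee_fin mulr_ge0 ?ppow_ge0 ?expR_ge0.
have mq : measurable_fun [set: R] q.
  by apply/measurable_EFinP; exact: measurable_eGamma.
apply: (@le_lt_trans _ _ (\int[mu]_t (p t + q t))%E); last first.
  rewrite ge0_integralD// lte_add_pinfty//; last exact: eGamma_ge0_lty.
  rewrite /p -integral_mkcond -(addrK 1 s); apply: le_lt_trans (ltry _).
  by apply: integral_powR_itv01; rewrite -ltrBlDr sub0r.
apply: ge0_le_integral => //.
- by move=> t _; rewrite lee_fin mulr_ge0 ?ppow_ge0 ?expR_ge0.
- by apply/measurable_EFinP; exact: measurable_eGamma.
- exact: emeasurable_funD.
move=> t _; have [t0|t0] := leP t 0.
  by rewrite ppow_le0// mul0r adde_ge0.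
have [t1|t1] := leP t 1.
  rewrite (le_trans _ (leeDl _ (q0 t)))// /p patchE mem_set/=; last first.
    by rewrite in_itv/= t0.
  by rewrite lee_fin ppowE// ler_piMr ?powR_ge0// expR_le1 oppr_le0 ltW.
rewrite (le_trans _ (leeDr _ (p0 t)))// lee_fin ler_wpM2r ?expR_ge0// !ppowE//.
by apply: ler_powR; exact: ltW.
Qed.

(** On [1, 2] the integrand is bounded below by the positive constant [m]. *)
Lemma eGamma_gt0 s : (0 < eGamma s)%E.
Proof.
pose m : R := expR (- (2 + `|s| * ln 2)).
have m0 : 0 < m by exact: expR_gt0.
apply: (@lt_le_trans _ _ (\int[mu]_(t in `[1%R, 2%R]) m%:E)%E).
  rewrite integral_cst//= lebesgue_measure_itv/= lte_fin ltr1n -EFinB -EFinM.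
  by rewrite lte_fin mulr_gt0// subr_gt0 ltr1n.
apply: (@le_trans _ _ (\int[mu]_(t in `[1%R, 2%R]) (ppow s t * expR (- t))%:E)%E).
  apply: ge0_le_integral => //.
  - by move=> t _; rewrite lee_fin ltW.
  - by apply/measurable_EFinP/measurable_funTS; exact: measurable_eGamma.
  move=> t /=; rewrite in_itv/= => /andP[t1 t2].
  have t0 : 0 < t by rewrite (lt_le_trans _ t1).
  rewrite lee_fin ppowE// /powR gt_eqF// -expRD ler_expR opprD addrC lerD// ?lerN2//.
  rewrite lerNl -mulNr; apply: le_trans (ler_norm _) _.
  rewrite normrM normrN ler_wpM2l// ger0_norm ?ln_ge0//.
  by rewrite ler_ln ?posrE.
apply: ge0_subset_integral => //.
- by apply/measurable_EFinP; exact: measurable_eGamma.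
- by move=> t _; rewrite lee_fin mulr_ge0 ?ppow_ge0 ?expR_ge0.
Qed.

Lemma eGamma_fin_num s : -1 < s -> (eGamma s \is a fin_num).
Proof. by move=> s1; rewrite ge0_fin_numE ?eGamma_ge0// eGamma_lty. Qed.

Lemma Gamma_gt0 s : 0 < s -> 0 < Gamma s.
Proof.
move=> s0; rewrite Gamma_eGamma fine_gt0// eGamma_gt0 eGamma_lty//.
by rewrite ltrBrDr addNr.
Qed.

Definition Beta a b : R := Gamma b * Gamma a / Gamma (a + b).

Lemma Beta_gt0 a b : 0 < a -> 0 < b -> 0 < Beta a b.
Proof. by move=> a0 b0; rewrite divr_gt0 ?mulr_gt0 ?Gamma_gt0// addr_gt0. Qed.

(** Divide [eGammaM] by Gamma(a + b). This factor is positive and the product of Gammas is finite,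
    so the convolution cannot be infinite. *)
Lemma conv_ppow_Beta a b x : 0 < a -> 0 < b ->
  conv_ppow (a - 1) (b - 1) x = (Beta a b * ppow (a + b - 1) x)%:E.
Proof.
move=> a0 b0; have ab0 : 0 < a + b by rewrite addr_gt0.
have gt_m1 c : 0 < c -> -1 < c - 1 :> R by move=> c0; rewrite ltrBrDr addNr.
rewrite conv_ppowE (_ : a - 1 + (b - 1) + 1 = a + b - 1); last by ring.
have := eGammaM R (a - 1) (b - 1).
rewrite (_ : a - 1 + (b - 1) + 1 = a + b - 1); last by ring.
rewrite -(fineK (eGamma_fin_num _ (gt_m1 _ a0))) -(fineK (eGamma_fin_num _ (gt_m1 _ b0))).
rewrite -(fineK (eGamma_fin_num _ (gt_m1 _ ab0))) -!Gamma_eGamma.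
have := Gamma_gt0 _ ab0; case: (conv_ppow _ _) => [c G0 /eqP| |].
- rewrite -!EFinM eqe => /eqP e; congr EFin; rewrite mulrC; congr (_ * _).
  by rewrite /Beta e mulrAC divff ?mul1r// gt_eqF.
- by move=> G0; rewrite gt0_muley ?lte_fin// -EFinM.
- by move=> G0; rewrite gt0_muleNy ?lte_fin// -EFinM.
Qed.

Lemma integrable_conv_ppow a b x : 0 < a -> 0 < b ->
  mu.-integrable setT (EFin \o (fun t => ppow (a - 1) (x - t) * ppow (b - 1) t)).
Proof.
move=> a0 b0; apply/integrableP; split.
  by apply/measurable_EFinP; exact: measurable_conv_ppow.
under eq_integral do rewrite /= ger0_norm ?mulr_ge0 ?ppow_ge0//.
by rewrite -/(conv_ppow (a - 1) (b - 1) x) conv_ppow_Beta// ltry.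
Qed.

Lemma Rintegral_conv_ppow a b x : 0 < a -> 0 < b ->
  \int[mu]_t (ppow (a - 1) (x - t) * ppow (b - 1) t) =
  Beta a b * ppow (a + b - 1) x.
Proof.
move=> a0 b0; rewrite /Rintegral.
by rewrite -/(conv_ppow (a - 1) (b - 1) x) conv_ppow_Beta.
Qed.

End Beta_integral.

Arguments Beta {R} a b.

(** * Bounds for the Kilbas-Saigo function *)

Lemma Rintegral_dominated_cvg d (T : measurableType d) (R : realType)
    (mu : {measure set T -> \bar R}) (f_ : nat -> T -> R) (f g : T -> R) :
  (forall n, measurable_fun setT (f_ n)) ->
  (forall x, f_ ^~ x @ \oo --> f x) ->
  mu.-integrable setT (EFin \o g) ->
  (forall n x, `|f_ n x| <= g x) ->
  mu.-integrable setT (EFin \o f) /\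
  (fun n => \int[mu]_x f_ n x) @ \oo --> \int[mu]_x f x.
Proof.
move=> mf_ f_f ig fg.
have mf : measurable_fun setT f by apply: measurable_fun_cvg mf_ _ => // x _.
have [|||||intf _ cf] := @dominated_convergence _ T R mu setT measurableT
  (fun n => EFin \o f_ n) (EFin \o f) (EFin \o g).
- by move=> n; exact/measurable_EFinP.
- exact/measurable_EFinP.
- by apply: aeW => x _; apply: cvg_EFin; [exact: nearW|exact: f_f].
- exact: ig.
- by apply: aeW => x n _; rewrite /= lee_fin.
split => //; move: cf; rewrite -[X in _ --> X]fineK; last exact: integrable_fin_num.
by move=> /fine_cvgP[].
Qed.

(** * Power series whose coefficient ratios tend to 0 *)

Section ratio_test.
Context (R : realType).
Implicit Types (c : nat -> R).

Lemma is_cvg_pseries_ratio c z : (forall n, 0 < c n) ->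
  (fun n => c n.+1 / c n) @ \oo --> (0 : R) -> cvgn (pseries c z).
Proof.
move=> c0 cc; pose u n : R := c n * `|z| ^+ n.
have u0 n : 0 <= u n by rewrite mulr_ge0 ?exprn_ge0// ltW.
have [K _ uK] : \forall n \near \oo, u n.+1 <= u n / 2.
  have e0 : 0 < (2 * (`|z| + 1))^-1 :> R by rewrite invr_gt0 mulr_gt0// ltr_wpDl.
  near=> n.
  have -> : u n.+1 = c n.+1 / c n * `|z| * u n.
    by rewrite /u exprS; field; rewrite gt_eqF.
  rewrite [leRHS]mulrC ler_wpM2r//.
  apply: (@le_trans _ _ ((2 * (`|z| + 1))^-1 * `|z|)).
    by rewrite ler_wpM2r// ltW//; near: n; exact: (cvgr_lt 0).
  by rewrite ler_pdivrMl ?mulr_gt0 ?ltr_wpDl// mulrAC divff// mul1r lerDl.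
(* Summing all weighted terms up to [K] makes the geometric bound hold for the initial terms too. *)
pose M := \sum_(i < K.+1) u i * 2 ^+ i.
have uM n : u n <= geometric M (2^-1) n.
  rewrite /geometric/= exprVn ler_pdivlMr ?exprn_gt0//.
  have [nK|Kn] := leqP n K.
    rewrite /M (bigD1 (Ordinal (nK : (n < K.+1)%N)))//= lerDl sumr_ge0// => i _.
    by rewrite mulr_ge0 ?exprn_ge0.
  elim: n Kn => // n ih; rewrite ltnS leq_eqVlt => Kn.
  have un : u n <= M / 2 ^+ n.
    case/predU1P: Kn => [<-|Kn]; last by rewrite ler_pdivlMr ?exprn_gt0// ih.
    rewrite /M ler_pdivlMr ?exprn_gt0// (bigD1 ord_max)//= lerDl sumr_ge0// => i _.
    by rewrite mulr_ge0 ?exprn_ge0.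
  have Kn' : (K <= n)%N by case/predU1P: Kn => [->|/ltnW].
  rewrite exprSr mulrA -ler_pdivlMr// -ler_pdivlMr ?exprn_gt0// mulrAC.
  by apply: le_trans (uK n Kn') _; rewrite ler_pM2r ?invr_gt0.
apply: normed_cvg; rewrite /normed_series_of /=.
rewrite (_ : (fun n => `|c n * z ^+ n|) = u); last first.
  by apply/funext => n; rewrite normrM normrX ger0_norm// ltW.
apply: (series_le_cvg u0 _ uM).
  move=> n; exact: le_trans (u0 n) (uM n).
by apply: is_cvg_geometric_series; rewrite ger0_norm ?invr_ge0// invf_lt1// ltr1n.
Unshelve. all: by end_near. Qed.

End ratio_test.

Section ratio_more.
Context (R : realType).
Implicit Types (c : nat -> R).

(** Differentiation multiplies the shifted ratio by (n + 2) / (n + 1), which is at most 2. *)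
Lemma ratio_pseries_diffs c : (forall n, 0 < c n) ->
  (fun n => c n.+1 / c n) @ \oo --> (0 : R) ->
  (fun n => pseries_diffs c n.+1 / pseries_diffs c n) @ \oo --> (0 : R).
Proof.
move=> c0 cc; have cc1 : (fun n => 2 * (c n.+2 / c n.+1)) @ \oo --> (0 : R).
  rewrite -(mulr0 2); apply: cvgMl_tmp.
  by rewrite (@cvg_shiftS _ (fun n => c n.+1 / c n)).
apply: (squeeze_cvgr _ (cvg_cst 0) cc1).
near=> n; rewrite /pseries_diffs; apply/andP; split.
  by rewrite divr_ge0 ?mulr_ge0// ltW.
rewrite invfM mulrACA ler_wpM2r ?divr_ge0 ?(ltW (c0 _))//.
by rewrite ler_pdivrMr// -natrM ler_nat mul2n doubleS !ltnS -addnn leq_addr.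
Unshelve. all: by end_near. Qed.

(** The first two formal derivatives satisfy the same ratio condition, so all three series converge
    everywhere and the sum is differentiable. *)
Lemma continuous_pseries_ratio c : (forall n, 0 < c n) ->
  (fun n => c n.+1 / c n) @ \oo --> (0 : R) ->
  continuous (fun z => limn (pseries c z)).
Proof.
move=> c0 cc z.
have d0 n : 0 < pseries_diffs c n by rewrite /pseries_diffs mulr_gt0.
have cd := ratio_pseries_diffs _ c0 cc.
have dd0 n : 0 < pseries_diffs (pseries_diffs c) n.
  by rewrite {1}/pseries_diffs mulr_gt0.
have cdd := ratio_pseries_diffs _ d0 cd.
have [] := @pseries_snd_diffs _ c (`|z| + 1) z (is_cvg_pseries_ratio _ _ _ c0 cc)
  (is_cvg_pseries_ratio _ _ _ d0 cd) (is_cvg_pseries_ratio _ _ _ dd0 cdd).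
  by rewrite [ltRHS]ger0_norm ?addr_ge0// ltrDl.
by move=> /derivable1_diffP/differentiable_continuous.
Qed.

End ratio_more.

(** * The Volterra equation and the bounds 0 < w < 1 *)

Section Volterra.
Context (R : realType).
Local Notation mu := (@lebesgue_measure R).
Variables (alpha beta : R).
Hypotheses (alpha0 : 0 < alpha) (beta0 : 0 <= beta).
Let gam := alpha + beta.
Implicit Types (x y z t : R).

(** [s k - 1] is the exponent of t in the k-th term of t^beta w(t). *)
Let s k : R := k%:R * gam + beta + 1.

(** The factor by which the Riemann-Liouville integral of order alpha multiplies t^(s k - 1), up to
    the power of t. *)
Definition KS_ratio k : R := Gamma (s k) / Gamma (s k + alpha).
Definition KS_coef k : R := \prod_(j < k) KS_ratio j.
Local Notation q := KS_ratio.
Local Notation c := KS_coef.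

Let gam0 : 0 < gam. Proof. by rewrite ltr_wpDr. Qed.

Let s_gt0 k : 0 < s k.
Proof. by rewrite ltr_wpDl// addr_ge0// mulr_ge0// ltW. Qed.

Lemma Beta_KS_ratio k : Beta alpha (s k) = Gamma alpha * q k.
Proof. by rewrite /Beta /KS_ratio [alpha + _]addrC; ring. Qed.

Lemma KS_ratio_gt0 k : 0 < q k.
Proof. by apply: divr_gt0; apply: Gamma_gt0 => //; exact: addr_gt0. Qed.

Lemma KS_coef_gt0 k : 0 < c k.
Proof. by apply: prodr_gt0 => j _; exact: KS_ratio_gt0. Qed.

Lemma KS_coefS k : c k.+1 = c k * q k.
Proof. by rewrite /KS_coef big_ord_recr. Qed.

Let ppow_s k t : ppow (s k - 1) t = ppow beta t * (ppow gam t) ^+ k.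
Proof.
rewrite /s addrK /ppow; case: ifPn => t0; last by rewrite mul0r.
rewrite addrC powRD ?(gt_eqF t0) ?implybT// [k%:R * _]mulrC powRrM powR_mulrn//.
exact: powR_ge0.
Qed.

(** Gamma(alpha) times the ratio is the integral of (1 - t)^(alpha - 1) t^(s k - 1) over [0, 1]. The
    integrands tend to 0 pointwise and are dominated by (1 - t)^(alpha - 1). *)
Lemma KS_ratio_cvg0 : q @ \oo --> (0 : R).
Proof.
suff : (fun k => Gamma alpha * q k) @ \oo --> (0 : R).
  have G0 := Gamma_gt0 R _ alpha0.
  move=> /(@cvgMl_tmp _ _ _ _ _ (Gamma alpha)^-1); rewrite mulr0; apply: cvg_trans.
  by apply: near_eq_cvg; apply: nearW => k; rewrite mulKf// gt_eqF.
have [||||_] := @Rintegral_dominated_cvg _ _ _ mu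
  (fun k t => ppow (alpha - 1) (1 - t) * ppow (s k - 1) t) (fun=> 0)
  (fun t => ppow (alpha - 1) (1 - t) * ppow (1 - 1) t).
- by move=> k; exact: measurable_conv_ppow.
- move=> t; have [t0|t0] := leP t 0.
    by under eq_fun do rewrite [ppow _ t]ppow_le0// mulr0; exact: cvg_cst.
  have [t1|t1] := leP 1 t.
    rewrite (_ : (fun _ => _) = fun=> 0); first exact: cvg_cst.
    by apply/funext => k; rewrite ppow_le0 ?mul0r// subr_le0.
  rewrite -(mulr0 (ppow (alpha - 1) (1 - t) * ppow beta t)).
  under eq_fun do rewrite ppow_s mulrA.
  apply: cvgMl_tmp; apply: cvg_expr.
  rewrite ger0_norm ?ppow_ge0// ppowE// -(powRr0 t).
  rewrite /powR !gt_eqF// mul0r ltr_expR.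
  by rewrite pmulr_rlt0// ln_lt0// t0.
- exact: integrable_conv_ppow.
- move=> k t; rewrite ger0_norm ?mulr_ge0 ?ppow_ge0//.
  have [t1|t1] := leP 1 t; first by rewrite ppow_le0 ?mul0r ?subr_le0.
  rewrite ler_wpM2l ?ppow_ge0//.
  have [t0|t0] := leP t 0; first by rewrite !ppow_le0.
  rewrite !ppowE//; apply: ger_powR; first by rewrite t0 ltW.
  by rewrite lerD2r /s lerDr addr_ge0// mulr_ge0// ltW.
rewrite [X in _ --> X](_ : _ = 0); last by rewrite /Rintegral integral0.
 apply: cvg_trans; apply: near_eq_cvg; apply: nearW => k /=.
rewrite Rintegral_conv_ppow// Beta_KS_ratio ppowE//.
by rewrite powR1 mulr1.
Qed.

Let KS_coef_ratio : (fun n => c n.+1 / c n) @ \oo --> (0 : R).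
Proof.
apply: cvg_trans KS_ratio_cvg0; apply: near_eq_cvg; apply: nearW => n.
by rewrite KS_coefS mulrC mulKf// gt_eqF// KS_coef_gt0.
Qed.

Definition KS z : R := limn (pseries c z).

Lemma is_cvg_KS z : cvgn (pseries c z).
Proof. by apply: is_cvg_pseries_ratio => //; exact: KS_coef_gt0. Qed.

Lemma continuous_KS : continuous KS.
Proof. by apply: continuous_pseries_ratio => //; exact: KS_coef_gt0. Qed.

Lemma pseries_S n z : pseries c z n.+1 = 1 + z * \sum_(0 <= k < n) c k.+1 * z ^+ k.
Proof.
rewrite /pseries/series/= big_nat_recl//= expr0 mulr1 {1}/KS_coef big_ord0.
by congr (_ + _); rewrite mulr_sumr; apply: eq_bigr => k _; rewrite exprS; ring.
Qed.

Lemma KS0 : KS 0 = 1.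
Proof.
apply/cvg_lim => //; rewrite -cvg_shiftS/=.
under eq_fun do rewrite pseries_S mul0r addr0.
exact: cvg_cst.
Qed.

Let kernel x t : R := ppow (alpha - 1) (x - t) * ppow beta t.

Let kernel_ge0 x t : 0 <= kernel x t.
Proof. by rewrite mulr_ge0 ?ppow_ge0. Qed.

Let kernel_out x t : ~~ (0 < t < x) -> kernel x t = 0.
Proof.
rewrite negb_and -!leNgt => /orP[t0|xt]; first by rewrite /kernel [X in _ * X]ppow_le0// mulr0.
by rewrite /kernel ppow_le0 ?mul0r// subr_le0.
Qed.

Let kernelE x t : kernel x t = ppow (alpha - 1) (x - t) * ppow (beta + 1 - 1) t.
Proof. by rewrite addrK. Qed.

Let beta1_gt0 : 0 < beta + 1. Proof. by rewrite ltr_wpDl. Qed.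

Let integrable_kernel x : mu.-integrable setT (EFin \o kernel x).
Proof.
rewrite (_ : kernel x = fun t => ppow (alpha - 1) (x - t) * ppow (beta + 1 - 1) t).
  exact: integrable_conv_ppow.
by apply/funext => t; rewrite kernelE.
Qed.

Let Rintegral_kernel x : 0 < x ->
  \int[mu]_t kernel x t = Beta alpha (beta + 1) * x `^ gam.
Proof.
move=> x0; under eq_Rintegral do rewrite kernelE.
by rewrite Rintegral_conv_ppow// addrA addrK ppowE.
Qed.

(** Integrating the k-th term against the kernel yields -Gamma(alpha) times the (k + 1)-st term at
    x: the exponent rises by gam and [Beta_KS_ratio] supplies the coefficient. *)
Let Rintegral_kernel_pseries x n : 0 < x ->
  mu.-integrable setT (EFin \o (fun t => kernel x t * pseries c (- ppow gam t) n)) /\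
  \int[mu]_t (kernel x t * pseries c (- ppow gam t) n) =
  Gamma alpha * (1 - pseries c (- (x `^ gam)) n.+1).
Proof.
move=> x0; elim: n => [|n [ih1 ih2]].
  rewrite (_ : (fun t => _) = fun=> 0); last first.
    by apply/funext => t; rewrite /pseries/series/= big_geq// mulr0.
  split; first exact: integrable0.
  by rewrite /Rintegral integral0 pseries_S big_geq// mulr0 addr0 subrr mulr0.
pose k t := ppow (alpha - 1) (x - t) * ppow (s n - 1) t.
have ik : mu.-integrable setT (EFin \o k) by exact: integrable_conv_ppow.
have ick : mu.-integrable setT (EFin \o (fun t => c n * (-1) ^+ n * k t)).
  rewrite (_ : _ \o _ = fun t => ((c n * (-1) ^+ n)%:E * (EFin \o k) t)%E) //.
  exact: integrableZl.
have -> : (fun t => kernel x t * pseries c (- ppow gam t) n.+1) =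
    (fun t => kernel x t * pseries c (- ppow gam t) n + c n * (-1) ^+ n * k t).
  apply/funext => t; rewrite /pseries/series/= big_nat_recr//= /k ppow_s /kernel.
  by rewrite mulrDr; congr (_ + _); rewrite [(- ppow gam t) ^+ n]exprNn; ring.
split.
  exact: (integrableD measurableT ih1 ick).
rewrite RintegralD// ih2 RintegralZl// Rintegral_conv_ppow// Beta_KS_ratio.
rewrite ppowE// (_ : alpha + s n - 1 = gam * n.+1%:R); last first.
  by rewrite /s /gam -natr1; ring.
rewrite powRrM powR_mulrn ?powR_ge0//.
rewrite [pseries c _ n.+2]/pseries/series/= big_nat_recr//= KS_coefS.
rewrite -[\sum_(0 <= i < n.+1) _]/(pseries c (- (x `^ gam)) n.+1).
by rewrite [(- (x `^ gam)) ^+ n.+1]exprNn [(-1) ^+ n.+1]exprS; ring.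
Qed.

(** Dominated convergence in the identity for partial sums; the series of absolute values at x
    bounds all of them for 0 < t < x. *)
Lemma KS_Volterra x : 0 < x ->
  mu.-integrable setT (EFin \o (fun t => kernel x t * KS (- ppow gam t))) /\
  \int[mu]_t (kernel x t * KS (- ppow gam t)) =
  Gamma alpha * (1 - KS (- (x `^ gam))).
Proof.
move=> x0; pose M := KS (x `^ gam).
have pos y : 0 <= y <= x `^ gam -> forall n, `|pseries c (- y) n| <= M.
  move=> /andP[y0 yx] n.
  apply: (@le_trans _ _ (pseries c (x `^ gam) n)).
    rewrite /pseries/series/=; apply: le_trans (ler_norm_sum _ _ _) _.
    apply: ler_sum => i _; rewrite normrM normrX normrN (ger0_norm y0).
    rewrite ger0_norm ?ler_wpM2l ?lerXn2r ?nnegrE ?powR_ge0// ltW// KS_coef_gt0//.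
  apply: nondecreasing_cvgn_le; last exact: is_cvg_KS.
  apply: nondecreasing_series => i _ _; rewrite mulr_ge0 ?exprn_ge0 ?powR_ge0//.
  by rewrite ltW// KS_coef_gt0.
have [||||int cv] := @Rintegral_dominated_cvg _ _ _ mu
  (fun n t => kernel x t * pseries c (- ppow gam t) n)
  (fun t => kernel x t * KS (- ppow gam t)) (fun t => M * kernel x t).
- move=> n; apply/measurable_EFinP.
  by have [/measurable_int] := Rintegral_kernel_pseries _ n x0.
- by move=> t; apply: cvgMl_tmp; exact: is_cvg_KS.
- rewrite (_ : _ \o _ = fun t => (M%:E * (EFin \o kernel x) t)%E) //.
  exact: integrableZl.
- move=> n t; rewrite normrM ger0_norm// mulrC.
  have [/andP[t0 tx]|tx] := boolP (0 < t < x); last by rewrite kernel_out// !mulr0.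
  rewrite ler_wpM2r// pos// ppow_ge0 ppowE// ge0_ler_powR ?nnegrE ?ltW//.
split=> //; apply: (cvg_unique _ cv) => //=.
rewrite [X in X @ _ --> _](_ : _ =
    fun n => Gamma alpha * (1 - pseries c (- (x `^ gam)) n.+1)); last first.
  by apply/funext => n; have [_] := Rintegral_kernel_pseries x n x0.
apply: cvgMl_tmp; apply: cvgB; first exact: cvg_cst.
by rewrite (@cvg_shiftS _ (pseries c _)); exact: is_cvg_KS.
Qed.

(** [ppow (1 - 1) (t - x)] is the indicator of t > x, so this is the part of the singular kernel
    over [x, y]; translation by x turns it into a convolution. *)
Let shifted_kernel x y :
  mu.-integrable setT (EFin \o (fun t => ppow (alpha - 1) (y - t) * ppow (1 - 1) (t - x))) /\
  \int[mu]_t (ppow (alpha - 1) (y - t) * ppow (1 - 1) (t - x)) =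
  Beta alpha 1 * ppow alpha (y - x).
Proof.
pose f t := ppow (alpha - 1) (y - t) * ppow (1 - 1) (t - x).
have f0 t : (0 <= (f t)%:E)%E by rewrite lee_fin mulr_ge0 ?ppow_ge0.
have mf : measurable_fun [set: R] (fun t => (f t)%:E).
  apply/measurable_EFinP; apply: measurable_funM; first exact: measurable_ppow_sub.
  by apply: (measurableT_comp (measurable_ppow R _)); exact: measurable_funB.
have intf : (\int[mu]_t (f t)%:E = (Beta alpha 1 * ppow alpha (y - x))%:E)%E.
  rewrite (ge0_integral_affine R 1 x _ ltr01 mf f0) mul1e.
  rewrite -[in ppow alpha _](addrK 1 alpha) -conv_ppow_Beta//.
  apply: eq_integral => t _.
  by rewrite /f mul1r addrK opprD [- t - x]addrC addrA.
split; last by rewrite /Rintegral intf.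
apply/integrableP; split => //.
apply: le_lt_trans (ltry (Beta alpha 1 * ppow alpha (y - x))).
rewrite -intf le_eqVlt; apply/orP; left; apply/eqP.
by apply: eq_integral => t _; exact: (gee0_abs (f0 t)).
Qed.

Hypothesis alpha1 : alpha <= 1.

(* The kernel [(x - t)^(alpha - 1)] is nonincreasing in [x], so passing from [x]
   to [y] only adds to the Volterra integral its part over [x, y]. *)
Let KS_decrease x y m : 0 < x < y -> 0 <= m ->
  (forall z, 0 <= z < y `^ gam -> 0 <= KS (- z)) ->
  (forall z, x `^ gam <= z <= y `^ gam -> KS (- z) <= m) ->
  Gamma alpha * (KS (- (x `^ gam)) - KS (- (y `^ gam))) <=
  y `^ beta * m * (Beta alpha 1 * (y - x) `^ alpha).
Proof.
move=> /andP[x0 xy] m0 KS_ge0 KS_le; have y0 := lt_trans x0 xy.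
have [ix ex] := KS_Volterra x x0; have [iy ey] := KS_Volterra y y0.
have [ih eh] := shifted_kernel x y.
rewrite ppowE ?subr_gt0// in eh.
rewrite -eh.
pose h t := y `^ beta * m *
  (ppow (alpha - 1) (y - t) * ppow (1 - 1) (t - x)).
have ih' : mu.-integrable setT (EFin \o h).
  exact: (integrableZl measurableT (y `^ beta * m) ih).
(* The pointwise comparison fails at [t = x], where both summands on the right
   vanish. *)
have Rintegral_setD1 f : mu.-integrable setT (EFin \o f) ->
    \int[mu]_(t in setT `\ x) f t = \int[mu]_t f t.
  move=> /measurable_int mf; rewrite /Rintegral integral_setD1//.
    exact: measurableD.
  by apply: measurable_funTS.
have le_ker : \int[mu]_t (kernel y t * KS (- ppow gam t)) <=
    \int[mu]_t (kernel x t * KS (- ppow gam t) + h t).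
  have ixh : mu.-integrable setT
      (EFin \o (fun t => kernel x t * KS (- ppow gam t) + h t)).
    exact: (integrableD measurableT ix ih').
  have mD : measurable ([set: R] `\ x) by exact: measurableD.
  rewrite -(Rintegral_setD1 _ iy) -(Rintegral_setD1 _ ixh).
  apply: le_Rintegral => //; [exact: integrableS iy|exact: integrableS ixh|].
  move=> t [_ /= /eqP tx].
  have h0 : 0 <= h t by rewrite !mulr_ge0 ?powR_ge0 ?ppow_ge0.
  have [/andP[t0 ty]|ty] := boolP (0 < t < y); last first.
    rewrite [kernel y t]kernel_out// mul0r addr_ge0//.
    have [/andP[t0 tx']|tx'] := boolP (0 < t < x); last by rewrite kernel_out// mul0r.
    by rewrite t0 (lt_trans tx' xy) in ty.
  have wt : ppow gam t < y `^ gam.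
    by rewrite ppowE// gt0_ltr_powR// nnegrE ltW.
  (* Left of x the kernels are compared and the nonnegative [h] is dropped; right of x only [h] is
     present, and it dominates through t^beta <= y^beta and the bound m. *)
  have [tx'|xt] := ltP t x.
    rewrite -[leLHS]addr0 lerD//.
    rewrite ler_wpM2r ?KS_ge0 ?ppow_ge0//.
    rewrite ler_wpM2r ?ppow_ge0// !ppowE ?subr_gt0//.
    rewrite -(opprB 1 alpha) !powRN lef_pV2 ?posrE ?powR_gt0 ?subr_gt0//.
    by rewrite ge0_ler_powR ?nnegrE ?subr_ge0 ?(ltW tx') ?(ltW ty)// lerB// ltW.
  have {tx}xt : x < t by rewrite lt_neqAle eq_sym tx.
  rewrite [kernel x t]kernel_out; last by rewrite t0 -leNgt ltW.
  rewrite mul0r add0r /h [ppow (1 - 1) _]ppowE ?subr_gt0// subrr powRr0 mulr1.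
  rewrite mulrC /kernel mulrCA [leRHS]mulrC ler_wpM2l ?ppow_ge0//.
  rewrite mulrC; apply: ler_pM; rewrite ?ppow_ge0// ?KS_ge0 ?ppow_ge0//.
    by rewrite ppowE// ge0_ler_powR ?nnegrE// ltW.
  by apply: KS_le; rewrite (ltW wt) andbT ppowE// ge0_ler_powR ?nnegrE// ltW.
move: le_ker; rewrite RintegralD// ex ey /h RintegralZl//.
lra.
Qed.

Let continuous_KSN : continuous (fun z => KS (- z)).
Proof.
by move=> z; apply: continuous_comp; [exact: opp_continuous|exact: continuous_KS].
Qed.

Let within_KSN a b : {within `[a, b], continuous (fun z => KS (- z))}.
Proof. by apply: continuous_subspaceT => z; exact: continuous_KSN. Qed.

Let powR_gamK z : 0 <= z -> (z `^ gam^-1) `^ gam = z.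
Proof. by move=> z0; rewrite -powRrM mulVf ?powRr1// gt_eqF. Qed.

(** Take the infimum of the points where the value is at most 0. Continuity keeps the value there at
    most 0, and [KS 0 = 1] makes the infimum positive. *)
Let KS_first_zero z : 0 <= z -> KS (- z) <= 0 ->
  exists z0, [/\ 0 < z0, KS (- z0) <= 0 & forall y, 0 <= y < z0 -> 0 < KS (- y)].
Proof.
move=> z_ge0 KSz; pose A := [set y | 0 <= y /\ KS (- y) <= 0].
have lbA : lbound A 0 by move=> y [].
have infA : has_inf A by split; [exists z|exists 0].
have KSinf : KS (- inf A) <= 0.
  rewrite leNgt; apply/negP => KSpos.
  have : \forall y \near inf A, 0 < KS (- y).
    exact: (cvgr_gt _ (continuous_KSN (inf A))).
  move=> /nbhs_ballP[e /= e0 KS_near].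
  have [a [a0 KSa] ae] := inf_adherent e0 infA.
  have := KS_near a; rewrite ltNge KSa => /(_ _)/negP; apply.
    have Aa : inf A <= a by apply: ge_inf; [exists 0|].
    by rewrite /ball/= ltr_distlC ltrBlDr (le_lt_trans Aa) ?ltrDl.
  by [].
exists (inf A); split => //.
  rewrite lt_neqAle lb_le_inf ?andbT//; last by exists z.
  apply/eqP => inf0; move: KSinf; rewrite -inf0 oppr0 KS0.
  by rewrite leNgt ltr01.
move=> y /andP[y0 yA]; rewrite ltNge; apply/negP => KSy.
by move: yA; rewrite ltNge => /negP; apply; apply: ge_inf; [exists 0|].
Qed.

(** Just before a first nonpositive point z0 the function must fall from its maximum on a short
    interval to at most 0. [KS_decrease] allows a fall of at most half that maximum. *)
Lemma KS_gt0 z : 0 <= z -> 0 < KS (- z).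
Proof.
move=> z_ge0; rewrite ltNge; apply/negP => /(KS_first_zero _ z_ge0)[z0 [z0_gt0 KSz0 KSpos]].
pose y := z0 `^ gam^-1; have y0 : 0 < y by exact: powR_gt0.
have yE : y `^ gam = z0 by rewrite powR_gamK// ltW.
have G0 := Gamma_gt0 R _ alpha0; have B0 := Beta_gt0 R _ _ alpha0 ltr01.
pose D := y `^ beta * Beta alpha 1.
have D0 : 0 < D by rewrite mulr_gt0// powR_gt0.
(* The first bound keeps [y - e] positive; the second makes the factor in [KS_decrease] at most
   Gamma(alpha) / 2. *)
pose e := Num.min (y / 2) ((Gamma alpha / (2 * D)) `^ alpha^-1).
have e0 : 0 < e by rewrite lt_min divr_gt0//= powR_gt0// divr_gt0// mulr_gt0.
have De : D * e `^ alpha <= Gamma alpha / 2.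
  apply: (@le_trans _ _ (D * (Gamma alpha / (2 * D)))).
    rewrite ler_pM2l//; set b := Gamma alpha / _.
    have <- : (b `^ alpha^-1) `^ alpha = b.
      rewrite -powRrM mulVf; last by rewrite gt_eqF.
      by rewrite powRr1// divr_ge0// ltW// mulr_gt0.
    apply: ge0_ler_powR; rewrite ?nnegrE ?powR_ge0 ?(ltW e0) ?(ltW alpha0)//.
    by rewrite /e ge_min lexx orbT.
  by rewrite le_eqVlt; apply/orP; left; apply/eqP; field; rewrite gt_eqF.
pose x := y - e.
have x0 : 0 < x.
  by rewrite subr_gt0 /e gt_min ltr_pdivrMr// ltr_pMr// ltr1n.
have xy : x < y by rewrite ltrBlDr ltrDl.
have xz0 : x `^ gam <= z0 by rewrite -yE ge0_ler_powR ?nnegrE// ltW.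
(* Starting from a maximizer makes the bound m in [KS_decrease] equal to the value at the left
   endpoint, so that this value cancels in the end. *)
have [w] := EVT_max xz0 (within_KSN _ _).
rewrite in_itv/= => /andP[xw wz0] w_max.
have w_ge0 : 0 <= w := le_trans (powR_ge0 _ _) xw.
have KSw : 0 < KS (- w).
  apply: (@lt_le_trans _ _ (KS (- (x `^ gam)))).
    by apply: KSpos; rewrite powR_ge0 -yE gt0_ltr_powR ?nnegrE// ltW.
  by apply: w_max; rewrite in_itv/= lexx.
have {wz0}wz0 : w < z0.
  rewrite lt_neqAle wz0 andbT; apply: contraTneq KSw => ->.
  by rewrite -leNgt.
pose v := w `^ gam^-1; have vE : v `^ gam = w by rewrite powR_gamK.
have w0 : 0 < w by apply: lt_le_trans xw; exact: powR_gt0.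
have v0 : 0 < v by exact: powR_gt0.
have vy : v < y by rewrite gt0_ltr_powR ?invr_gt0 ?nnegrE// ltW.
have xv : x <= v.
  have -> : x = (x `^ gam) `^ gam^-1.
    by rewrite -powRrM divff ?powRr1 ?gt_eqF// ltW.
  by rewrite ge0_ler_powR ?nnegrE ?powR_ge0 ?invr_ge0// ltW.
have vxy : 0 < v < y by rewrite v0.
have KS_ge0 u : 0 <= u < y `^ gam -> 0 <= KS (- u) by rewrite yE => /KSpos/ltW.
have KS_max u : v `^ gam <= u <= y `^ gam -> KS (- u) <= KS (- w).
  by rewrite vE yE => /andP[wu uz0]; apply: w_max; rewrite in_itv/= uz0 (le_trans xw).
have := KS_decrease _ _ _ vxy (ltW KSw) KS_ge0 KS_max; rewrite vE yE => KS_le.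
have : Gamma alpha * KS (- w) <= KS (- w) * (Gamma alpha / 2).
  apply: (@le_trans _ _ (KS (- w) * (D * (y - v) `^ alpha))).
    apply: le_trans (le_trans _ KS_le) _; last first.
      by rewrite le_eqVlt; apply/orP; left; apply/eqP; rewrite /D; ring.
    by rewrite ler_pM2l// lerDl oppr_ge0.
  rewrite ler_pM2l// (le_trans _ De)// ler_pM2l//.
  apply: ge0_ler_powR; rewrite ?nnegrE ?subr_ge0 ?(ltW vy) ?(ltW e0) ?(ltW alpha0)//.
  by rewrite lerBlDl -lerBlDr.
by rewrite mulrC ler_pM2l// leNgt ltr_pdivrMr// ltr_pMr// ltr1n.
Qed.

(** On [0, z] the function is at least its positive minimum, so the Volterra integral, which is
    Gamma(alpha) (1 - w), is positive. *)
Lemma KS_lt1 z : 0 < z -> KS (- z) < 1.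
Proof.
move=> z0; pose x := z `^ gam^-1; have x0 : 0 < x by exact: powR_gt0.
have xE : x `^ gam = z by rewrite powR_gamK// ltW.
have [w] := EVT_min (ltW z0) (within_KSN _ _).
rewrite in_itv/= => /andP[w0 wz] w_min.
have KSw : 0 < KS (- w) by exact: KS_gt0.
have [ix ex] := KS_Volterra x x0; rewrite xE in ex.
have ik := integrableZl measurableT (KS (- w)) (integrable_kernel x).
have : KS (- w) * \int[mu]_t kernel x t <= \int[mu]_t (kernel x t * KS (- ppow gam t)).
  rewrite -RintegralZl//; apply: le_Rintegral => // t _.
  have [/andP[t0 tx]|tx] := boolP (0 < t < x); last by rewrite kernel_out// mulr0 mul0r.
  rewrite mulrC ler_wpM2l// w_min// in_itv/= ppow_ge0 ppowE// -xE.
  by rewrite ge0_ler_powR ?nnegrE// ltW.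
rewrite ex Rintegral_kernel// => h.
have : 0 < Gamma alpha * (1 - KS (- z)).
  by apply: lt_le_trans h; rewrite mulr_gt0// mulr_gt0 ?powR_gt0// Beta_gt0.
by rewrite pmulr_rgt0 ?Gamma_gt0// subr_gt0.
Qed.

End Volterra.

Arguments KS_ratio {R} alpha beta k.
Arguments KS_coef {R} alpha beta k.
Arguments KS {R} alpha beta z.

(** The parameter 1 + 2 beta / alpha shifts every Gamma argument by one index: the k-th coefficient
    is [KS_coef k.+1] divided by the ratio of index 0. The series is therefore (1 - w) / (z q_0),
    and [KS_lt1] applies. *)
Lemma sigma_gt0 (R : realType) (alpha beta l lam : R) :
  0 < alpha <= 1 -> 0 <= beta -> 0 < l -> 0 < lam ->
  0 < sigma_ alpha beta l lam.
Proof.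
move=> /andP[alpha0 alpha1] beta0 l0 lam0.
have sl0 : 0 < Num.sqrt lam by rewrite sqrtr_gt0.
have lg0 : 0 < l `^ (alpha + beta) by exact: powR_gt0.
rewrite /sigma_; set z := Num.sqrt lam * _.
have z0 : 0 < z by rewrite mulr_gt0.
pose q := KS_ratio alpha beta.
have eta_q : eta2 alpha beta = q 0%N.
  by rewrite /q /KS_ratio mul0r add0r /eta2; congr (Gamma _ / Gamma _); ring.
have q0 : 0 < q 0%N by exact: KS_ratio_gt0.
have -> : kilbas_saigo alpha (1 + beta / alpha) (1 + 2 * beta / alpha) (- z) =
    (1 - KS alpha beta (- z)) / (z * q 0%N).
  apply/cvg_lim => //.
  have -> : (1 - KS alpha beta (- z)) / (z * q 0%N) =
      (- (z * q 0%N))^-1 * (KS alpha beta (- z) - 1).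
    by rewrite invrN mulNr -mulrN opprB mulrC.
  rewrite (_ : series _ = fun n => (- (z * q 0%N))^-1 *
      (pseries (KS_coef alpha beta) (- z) n.+1 - 1)).
    apply: cvgMl_tmp; apply: cvgB; last exact: cvg_cst.
    by rewrite (@cvg_shiftS _ (pseries _ _)); exact: is_cvg_KS.
  apply/funext => n; rewrite pseries_S addrAC subrr add0r.
  rewrite mulNr mulrN invrN mulNr opprK /series/= !mulr_sumr.
  apply: eq_bigr => k _; rewrite /KS_coef big_ord_recl /= -/q.
  rewrite (_ : \prod_(j < k) _ = \prod_(j < k) q (bump 0 j)).
    by field; rewrite !gt_eqF.
  apply: eq_bigr => j _; rewrite /q /KS_ratio /bump add1n -natr1.
  by congr (Gamma _ / Gamma _); field; rewrite gt_eqF.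
rewrite eta_q mulr_gt0//; first by rewrite mulr_gt0// divr_gt0.
have zq0 : 0 < z * q 0%N by exact: mulr_gt0.
by apply: divr_gt0 => //; rewrite subr_gt0 KS_lt1.
Qed.

(** In the application, A is the norm of the noise-free data, D the sum of the inverse [sigma_], and
    G the l^1 norm of the coefficients of the truncated source. A bounded X uses the linear
    estimate, a large X the square-root one. *)
Lemma powR_interpolation (R : realType) (p M A D G X delta rho err : R) :
  0 < p -> 0 < M -> 0 <= A -> 0 <= D -> 0 <= G -> 0 < delta -> 1 < rho ->
  noise_range M p delta rho -> X = (1 + rho) * delta ->
  rho * delta <= A + delta ->
  err <= D * X -> err <= D * Num.sqrt (A ^+ 2 + 2 * A * delta) + G ->
  err <= (D * (1 + A * (2 * M + 2) + 2 * M) + D * (A + 1) + G) * X `^ (p / (p + 2)).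
Proof.
move=> p0 M0 A0 D0 G0 delta0 rho1 range XE rhoA err1 err2.
(* [X0] exceeds 1 and both bounds on X obtained below, A + 2 M and A + 2 A M. *)
set X0 := 1 + _ + _; set q := p / _.
have AM0 : 0 <= A * (2 * M + 2) by rewrite mulr_ge0// addr_ge0// mulr_ge0// ltW.
have X01 : 1 <= X0 by rewrite /X0 -addrA lerDl addr_ge0// mulr_ge0// ltW.
have p20 : 0 < p + 2 by rewrite addr_gt0.
have q1 : q <= 1 by rewrite ler_pdivrMr// mul1r lerDl.
have q0 : 0 <= q by rewrite divr_ge0// ltW.
have Xpos : 0 < X by rewrite XE mulr_gt0// addr_gt0// (lt_trans ltr01).
have Xq0 : 0 <= X `^ q by exact: powR_ge0.
have small : X <= X0 -> err <= (D * X0 + D * (A + 1) + G) * X `^ q.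
  move=> XX0; apply: (@le_trans _ _ (D * X0 * X `^ q)); last first.
    by rewrite ler_wpM2r// -addrA lerDl addr_ge0// mulr_ge0// addr_ge0.
  apply: le_trans err1 _; rewrite -mulrA ler_wpM2l//.
  have [X1|X1] := leP X 1.
    rewrite -[leLHS]mul1r; apply: ler_pM => //; first exact: ltW.
    by apply: ger1_powR => //; rewrite Xpos.
  apply: le_trans XX0 _; rewrite ler_peMr ?(le_trans ler01)//.
  by rewrite -(powRr0 X) ler_powR// ltW.
have XA : X <= A + 2 * delta by rewrite XE; lra.
case: range => [dM|rM|p2].
- apply: small; apply: (le_trans XA); rewrite /X0.
  have : 0 <= A * M by rewrite mulr_ge0// ltW.
  lra.
(* The hypothesis [rhoA] says (rho - 1) delta <= A, so here delta <= A M. *)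
- apply: small; apply: (le_trans XA); rewrite /X0.
  have : delta <= A * M.
    rewrite -ler_pdivrMr//.
    have : (1 + M^-1) * delta <= rho * delta by rewrite ler_pM2r.
    rewrite [delta / M]mulrC; lra.
  lra.
(* For 2 <= p the exponent is at least 1/2, so X^q dominates the square root of X when X >= 1;
   moreover A^2 + 2 A delta <= (A + 1)^2 X. *)
- have [/small//|XX0] := leP X X0.
  have X1 : 1 <= X by rewrite (le_trans X01)// ltW.
  have deltaX : delta <= X by rewrite XE ler_peMl ?ltW// ltrDl (lt_trans ltr01).
  have sX : 1 <= Num.sqrt X by rewrite -sqrtr1 ler_wsqrtr.
  apply: (@le_trans _ _ ((D * (A + 1) + G) * Num.sqrt X)).
    apply: le_trans err2 _; rewrite [leRHS]mulrDl lerD//; last by rewrite ler_peMr.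
    rewrite -[leRHS]mulrA ler_wpM2l// -[A + 1]ger0_norm ?addr_ge0// -sqrtr_sqr.
    rewrite -sqrtrM ?sqr_ge0// ler_wsqrtr//.
    have : A ^+ 2 <= A ^+ 2 * X by rewrite ler_peMr ?sqr_ge0.
    have : 2 * A * delta <= 2 * A * X by rewrite ler_wpM2l// mulr_ge0.
    lra.
  apply: (@le_trans _ _ ((D * (A + 1) + G) * X `^ q)).
    rewrite ler_wpM2l ?addr_ge0 ?mulr_ge0 ?addr_ge0//.
    by rewrite -powR12_sqrt ?(ltW Xpos)// ler_powR// /q ler_pdivlMr//; lra.
  by rewrite ler_wpM2r// -addrA lerDr mulr_ge0// (le_trans ler01).
Qed.

(** * The discrepancy principle *)

Section discrepancy.
Context (R : realType) (d : nat) (Omega : set 'rV[R]_d).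
Local Notation L2 := (L2 Omega).
Local Notation inner := (inner Omega).
Local Notation norm2 := (norm2 Omega).
Variable phi : nat -> 'rV[R]_d -> R.
Hypothesis Lphi : forall k, L2 (phi k).
Hypothesis on_phi : forall i j, inner (phi i) (phi j) = (i == j)%:R.
(** Here s stands for [sigma_], t for the penalty tau exp(lam^r), x and g for the coefficients of
    the regularized and the exact source, B and u for the noise-free and the noisy data, w for K
    applied to the regularized solution. *)
Variables (s t x g : nat -> R) (N : nat) (B u w : 'rV[R]_d -> R) (delta rho : R).
Local Notation S := (partial_sum phi).
Hypothesis s0 : forall k, 0 < s k.
Hypothesis t0 : forall k, 0 < t k.
Hypothesis LB : L2 B.
Hypothesis Lu : L2 u.
Hypothesis coefB : forall k, (k < N)%N -> inner B (phi k) = s k * g k.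
Hypothesis x_def : forall k, (k < N)%N -> x k = (s k + t k)^-1 * inner u (phi k).
Hypothesis delta0 : 0 < delta.
Hypothesis rho1 : 1 < rho.
Hypothesis noise : norm2 (B \- u) <= delta.
Hypothesis w_def : L2_series Omega phi (fun k => s k * inner (S x N) (phi k)) w.
Hypothesis discr : norm2 (w \- u) = rho * delta.

Let y k := s k * inner (S x N) (phi k).

Let yE k : (k < N)%N -> y k = s k * x k.
Proof. by move=> kN; rewrite /y (coef_partial_sum _ _ _ _ Lphi on_phi) kN. Qed.

Let LS c : L2 (S c N). Proof. exact: L2_partial_sum. Qed.

(** Only N coefficients of w are nonzero, so w may be replaced by the finite sum with coefficients
    [y]. *)
Let residual : norm2 (S y N \- u) = rho * delta.
Proof.
have Lw : L2 w by case: w_def.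
have y0 k : (N <= k)%N -> y k = 0.
  by move=> Nk; rewrite /y (coef_partial_sum _ _ _ _ Lphi on_phi) ltnNge Nk mulr0.
have Sw : norm2 (S y N \- w) = 0 by exact: L2_series_finite y0 w_def.
apply/eqP; rewrite eq_le -discr; apply/andP; split.
  by have := norm2_triangle _ _ _ _ _ _ (LS y) Lw Lu; rewrite Sw add0r.
have := norm2_triangle _ _ _ _ _ _ Lw (LS y) Lu.
by rewrite (norm2_subC _ _ _ w (S y N)) Sw add0r.
Qed.

Lemma discrepancy_coef_error k : (k < N)%N ->
  `|x k - g k| <= (1 + rho) * delta / s k.
Proof.
move=> kN; rewrite ler_pdivlMr// -{1}(gtr0_norm (s0 k)) -normrM.
have -> : (x k - g k) * s k =
    inner (S y N \- u) (phi k) - inner (B \- u) (phi k).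
  rewrite !innerBl// coefB// (coef_partial_sum _ _ _ _ Lphi on_phi) kN yE//; ring.
apply: le_trans (ler_normB _ _) _; rewrite addrC mulrDl mul1r lerD//.
  by rewrite (le_trans _ noise)// coef_le_norm2//; exact: L2B.
by rewrite -residual coef_le_norm2//; exact: L2B.
Qed.

(** With u_k = (s_k + t_k) x_k and y_k = s_k x_k, the difference u_k^2 - (y_k - u_k)^2 - y_k^2 is 2
    s_k t_k x_k^2, hence nonnegative. *)
Let sum_sqr_y : \sum_(k < N) y k ^+ 2 <= norm2 u ^+ 2 - (rho * delta) ^+ 2.
Proof.
rewrite -residual (sqr_norm2_partial_sumB _ _ _ _ Lphi on_phi)// opprD addrCA subrr addr0.
rewrite -sumrN; apply: ler_sum => k _.
have kN := ltn_ord k; have sk := s0 k; have tk := t0 k.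
have e : inner u (phi k) = x k * (s k + t k).
  by rewrite x_def//; field; rewrite gt_eqF// addr_gt0.
rewrite yE// e -subr_ge0.
rewrite (_ : _ - _ = 2 * (s k * t k) * x k ^+ 2); last by ring.
by rewrite mulr_ge0 ?sqr_ge0// mulr_ge0// ltW// mulr_gt0.
Qed.

Let norm2_data : norm2 u <= norm2 B + delta.
Proof.
rewrite (_ : u = B \- (B \- u)); last by apply/funext => z /=; ring.
apply: le_trans (norm2B _ _ _ _ _ LB (L2B _ _ _ _ _ LB Lu)) _.
by rewrite lerD2l.
Qed.

(** By [sum_sqr_y] the residual is at most the norm of the noisy data. This limits delta as soon as
    rho stays away from 1. *)
Lemma discrepancy_noise_le : rho * delta <= norm2 B + delta.
Proof.
apply: le_trans norm2_data.
rewrite -ler_sqr ?nnegrE ?norm2_ge0// ?mulr_ge0 ?(ltW delta0) ?(le_trans ler01 (ltW rho1))//.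
rewrite -subr_ge0; apply: le_trans sum_sqr_y.
by apply: sumr_ge0 => k _; exact: sqr_ge0.
Qed.

(** In (norm2 B + delta)^2 - (rho delta)^2 the square of delta is cancelled because rho > 1; only
    growth of order the square root of delta is left. *)
Lemma discrepancy_coef_le k : (k < N)%N ->
  `|x k| <= Num.sqrt (norm2 B ^+ 2 + 2 * norm2 B * delta) / s k.
Proof.
move=> kN; rewrite ler_pdivlMr// -{1}(gtr0_norm (s0 k)) -normrM mulrC -yE//.
rewrite -sqrtr_sqr ler_wsqrtr//.
have h : y k ^+ 2 <= \sum_(k < N) y k ^+ 2.
  by rewrite (bigD1 (Ordinal kN))//= lerDl sumr_ge0// => i _; exact: sqr_ge0.
apply: le_trans h _; apply: le_trans sum_sqr_y _.
have : norm2 u ^+ 2 <= (norm2 B + delta) ^+ 2.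
  by rewrite ler_sqr ?nnegrE ?addr_ge0 ?norm2_ge0 ?(ltW delta0).
have : delta ^+ 2 <= (rho * delta) ^+ 2.
  rewrite ler_sqr ?nnegrE ?mulr_ge0 ?(ltW delta0) ?(le_trans ler01 (ltW rho1))//.
  by rewrite ler_peMl ?ltW.
rewrite sqrrD; lra.
Qed.

Lemma discrepancy_error :
  norm2 (S x N \- S g N) <= (\sum_(k < N) (s k)^-1) * ((1 + rho) * delta) /\
  norm2 (S x N \- S g N) <=
    (\sum_(k < N) (s k)^-1) * Num.sqrt (norm2 B ^+ 2 + 2 * norm2 B * delta)
    + \sum_(k < N) `|g k|.
Proof.
have -> : S x N \- S g N = S (fun k => x k - g k) N.
  apply/funext => z; rewrite /partial_sum /= -sumrB.
  by apply: eq_bigr => k _; rewrite mulrBl.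
have h := norm2_partial_sum _ _ _ _ Lphi on_phi (fun k => x k - g k) N.
split; apply: le_trans h _; rewrite mulr_suml -?big_split; apply: ler_sum => k _ /=.
  by rewrite mulrC discrepancy_coef_error.
by rewrite (le_trans (ler_normB _ _))// lerD2r mulrC discrepancy_coef_le.
Qed.

End discrepancy.

(** * Assembly of the error bound from the coefficient estimates *)

Theorem theorem9 (R : realType) (d : nat) (Omega : set 'rV[R]_d)
  (L : ('rV[R]_d -> R) -> 'rV[R]_d -> R)
  (lam : nat -> R) (phi : nat -> 'rV[R]_d -> R)
  (alpha beta l r : R) (f g h : 'rV[R]_d -> R) :
  (1 <= d)%N -> domain Omega -> smooth_boundary Omega ->
  symmetric_uniformly_elliptic Omega L ->
  eigensystem Omega L lam phi ->
  0 < alpha <= 1 -> 0 <= beta -> 0 < l ->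
  L2 Omega f -> L2 Omega g ->
  exact_trace Omega phi lam alpha beta l f g h ->
  forall p M : R, 0 < p -> 0 < M ->
  exists C : nat -> R, (forall N, 0 < C N) /\
  forall zeta1 zeta2 : R, 0 < zeta1 -> 0 < zeta2 ->
  (exists N : nat, [/\ (1 <= N)%N,
     norm2 Omega (g \- truncation Omega phi g N) <= zeta1 &
     norm2 Omega (f \- truncation Omega phi f N) <= zeta2]) /\
  forall N : nat, (1 <= N)%N ->
  norm2 Omega (g \- truncation Omega phi g N) <= zeta1 ->
  norm2 Omega (f \- truncation Omega phi f N) <= zeta2 ->
  forall (delta tau rho : R) (hdelta : 'rV[R]_d -> R),
  0 < delta -> 0 < tau -> 1 < rho -> noise_range M p delta rho ->
  L2 Omega hdelta -> norm2 Omega (hdelta \- h) <= delta ->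
  discrepancy_principle Omega phi lam alpha beta l r tau rho delta f hdelta N ->
  norm2 Omega
    (regularized_solution Omega phi lam alpha beta l r tau f hdelta N \- g)
  <= C N * ((1 + rho) `^ (p / (p + 2)) * delta `^ (p / (p + 2))
            + zeta2 `^ (p / (p + 2)) + zeta1 `^ (p / (p + 2))) + zeta1.
Proof.
move=> _ _ _ _ [_ lam0 lam_homo _ [Lphi on_phi phi_basis]] alpha01 beta0 l0 Lf Lg.
move=> [F [Kg [Fseries Kgseries ->]]] p M p0 M0.
have LF : L2 Omega F by case: Fseries.
have LKg : L2 Omega Kg by case: Kgseries.
pose s k := sigma_ alpha beta l (lam k).
have s0 k : 0 < s k.
  by apply: sigma_gt0 => //; rewrite (lt_le_trans lam0)// lam_homo.
pose fe k := inner Omega f (phi k) * e_ alpha beta l (lam k).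
pose gk k := inner Omega g (phi k).
pose B N := partial_sum phi fe N \- (F \- Kg).
have LS c N : L2 Omega (partial_sum phi c N) by exact: L2_partial_sum.
have LB N : L2 Omega (B N) by rewrite /B; do 2 ?apply: L2B.
pose A N := norm2 Omega (B N).
pose D N := \sum_(k < N) (s k)^-1.
pose G N := \sum_(k < N) `|gk k|.
have A0 N : 0 <= A N by exact: norm2_ge0.
have D0 N : 0 <= D N by apply: sumr_ge0 => k _; rewrite invr_ge0 ltW.
have G0 N : 0 <= G N by exact: sumr_ge0.
(* The constant produced by [powR_interpolation]; it may vanish, so 1 is added to it below. *)
pose C0 N := D N * (1 + A N * (2 * M + 2) + 2 * M) + D N * (A N + 1) + G N.
have C00 N : 0 <= C0 N.
  by rewrite !addr_ge0 ?mulr_ge0 ?addr_ge0 ?mulr_ge0 ?addr_ge0 ?mulr_ge0 ?(ltW M0).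
exists (fun N => C0 N + 1); split => [N|zeta1 zeta2 zeta10 zeta20].
  by rewrite ltr_wpDl.
split.
  have trunc v zeta : L2 Omega v -> 0 < zeta ->
      \forall N \near \oo, norm2 Omega (v \- truncation Omega phi v N) <= zeta.
    move=> Lv zeta0; have [_ cv] := phi_basis v Lv.
    near=> N; rewrite norm2_subC; apply: ltW.
    by near: N; exact: (cvgr_lt _ cv).
  near \oo => N; exists N; split; first by near: N; exact: nbhs_infty_ge.
    by near: N; exact: trunc.
  by near: N; exact: trunc.
move=> N _ trunc_g _ delta tau rho hdelta delta0 tau0 rho1 range Lh noise.
move=> [w w_def discr].
pose t k := tau * expR (lam k `^ r).
have t0 k : 0 < t k by rewrite mulr_gt0// expR_gt0.
pose x k := (s k + t k)^-1 * noisy_coef Omega phi lam alpha beta l f hdelta k.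
pose u := noisy_data Omega phi lam alpha beta l f hdelta N.
have Lu : L2 Omega u by exact: L2B.
(* Below N the contributions of f to the finite sum and to the exact trace cancel, leaving the
   coefficient of K g. *)
have coefB k : (k < N)%N -> inner Omega (B N) (phi k) = s k * gk k.
  move=> kN; rewrite /B !innerBl//; last exact: L2B.
  rewrite (coef_partial_sum _ _ _ _ Lphi on_phi) kN.
  rewrite (coef_L2_series _ _ _ _ Lphi on_phi _ _ Fseries).
  by rewrite (coef_L2_series _ _ _ _ Lphi on_phi _ _ Kgseries) opprB addrCA subrr addr0.
have x_def k : (k < N)%N -> x k = (s k + t k)^-1 * inner Omega u (phi k).
  move=> kN; rewrite /u /noisy_data innerBl//.
  by rewrite (coef_partial_sum _ _ _ _ Lphi on_phi) kN.
have noiseB : norm2 Omega (B N \- u) <= delta.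
  rewrite (_ : B N \- u = hdelta \- (F \- Kg))//.
  by apply/funext => z; rewrite /B /u /noisy_data /=; ring.
have [err1 err2] := discrepancy_error R d Omega phi Lphi on_phi s t x gk N (B N) u w
  delta rho s0 t0 (LB N) Lu coefB x_def delta0 rho1 noiseB w_def discr.
have rhoA := discrepancy_noise_le R d Omega phi Lphi on_phi s t x N (B N) u w
  delta rho s0 t0 (LB N) Lu x_def delta0 rho1 noiseB w_def discr.
have X0 := powR_interpolation _ _ _ _ _ _ _ _ _ _ p0 M0 (A0 N) (D0 N) (G0 N) delta0 rho1
  range erefl rhoA err1 err2.
have LT : L2 Omega (truncation Omega phi g N) by exact: LS.
(* The truncation of g serves as intermediate point; its distance to g accounts for the separate
   [zeta1]. *)
apply: le_trans (norm2_triangle _ _ _ _ _ _ (LS x N) LT Lg) _.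
apply: lerD; last by rewrite norm2_subC.
apply: le_trans X0 _; rewrite -/(C0 N).
rewrite powRM ?addr_ge0 ?(ltW delta0) ?(le_trans ler01 (ltW rho1))//.
apply: ler_pM => //; first by rewrite mulr_ge0 ?powR_ge0.
  by rewrite lerDl.
by rewrite -addrA lerDl addr_ge0 ?powR_ge0.
Unshelve. all: by end_near. Qed.
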